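(* Let $K>0$ and $c>0$. Suppose $g$ and $h$ are increasing real functions on $[1,\infty)$ with $0\le g(x)\le h(x)$, $h(x^2)-h(x)\le K$ and $g(x^2)-g(x)\le K$ for all $x\ge 1$. Suppose that, for all large $x$, $H(p)\ge h(p)$ for at least $c\,\pi(x)$ primes $p\le x$. Then, for all large $x$, $H(p)\ge h(p)-g(p)$ for all primes $p\le x$ with at most $$O\left(\pi(x)\exp\left\{-\frac{c\log 2}{K}\,g(x)\right\}\right)$$ exceptions.
   Context: For positive integers $a,b$ write $a\prec b$ if $b\equiv 1\pmod a$. A prime chain (of length $k\ge 1$) is a sequence of primes $p_1\prec p_2\prec\cdots\prec p_k$. For a prime $p$, $H(p)$ is the length $k$ of the longest prime chain with $p_k=p$. $\pi(x)$ is the number of primes $\le x$. ''Large $x$'' means $x\ge x_0$ where $x_0$ may depend on $g,h,K,c$; the implied constant in $O$ is absolute. *)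

(* Defs.v *)
From mathcomp Require Import all_boot all_order all_algebra.
From mathcomp Require Import boolp reals.

Set Implicit Arguments.
Unset Strict Implicit.
Unset Printing Implicit Defensive.

Import Order.TTheory GRing.Theory Num.Theory.

Definition prec (a b : nat) : bool := b == 1 %[mod a].

Definition prime_chain (s : seq nat) : bool :=
  [&& s != [::], all prime s & sorted prec s].

Definition chain_to (p k : nat) : Prop :=
  exists s : seq nat, [/\ prime_chain s, last 0 s = p & size s = k].

(* A chain ending at p is strictly increasing, so its length is at most p
   (chain_to_le): bounding the range of k loses nothing, and H p is the
   maximum of the lengths of all chains ending at p (H_attained, H_max). *)
Definition H (p : nat) : nat := \max_(k < p.+1 | `[< chain_to p k >]) k.

Lemma prec_ltn a b : prime a -> prime b -> prec a b -> a < b.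
Proof.
move=> pa pb; rewrite /prec (eqn_mod_dvd _ (prime_gt0 pb)) => /dvdn_leq.
rewrite subn_gt0 (prime_gt1 pb) => /(_ isT) le_ab.
by apply: leq_ltn_trans le_ab _; rewrite ltn_subrL /= (prime_gt0 pb).
Qed.

Lemma chain_to_le p k : chain_to p k -> k <= p.
Proof.
case=> -[|a s] [/and3P[// _ /= /andP[pa ps] chs] <- <-] /=.
elim: s a pa ps chs => [|b s IHs] a pa //=; first by rewrite prime_gt0.
move=> /andP[pb ps] /andP[ab chs].
have lt_last c t : prime c -> all prime t -> path prec c t -> c + size t <= last c t.
  elim: t c => [|d t IHt] c pc /=; first by rewrite addn0.
  move=> /andP[pd pt] /andP[/(prec_ltn pc pd) lt_cd cht].
  by apply: leq_trans (IHt d pd pt cht); rewrite addnS -addSn leq_add2r.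
apply: leq_trans (lt_last b s pb ps chs).
rewrite -[(size s).+2]/(2 + size s) leq_add2r.
exact: prime_gt1.
Qed.

Lemma H_attained p : prime p -> chain_to p (H p).
Proof.
move=> pp; have ch1 : chain_to p 1.
  by exists [:: p]; rewrite /prime_chain /= pp.
have lt1 : 1 < p.+1 by rewrite ltnS prime_gt0.
rewrite /H (bigop.bigmax_eq_arg (Ordinal lt1)); last exact/asboolP.
by case: arg_maxnP => [|k /asboolP]; first exact/asboolP.
Qed.

Lemma H_max p k : chain_to p k -> k <= H p.
Proof.
move=> chk; have ltk : k < p.+1 by rewrite ltnS chain_to_le.
exact: (leq_bigmax_cond (Ordinal ltk) (introT (asboolP _) chk)).
Qed.

Local Open Scope ring_scope.

(* Num.truncn x is 0 for x < 0, so no prime is counted there. *)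
Definition count_primes (R : realType) (x : R) (P : pred nat) : nat :=
  #|[set p : 'I_(Num.truncn x).+1 | prime p && P p]|.

Definition prime_pi (R : realType) (x : R) : nat := count_primes x predT.

(* Main.v *)
(* Scales are measured by tower i = 2 ^ 2 ^ i, so that h and g grow by at most K
   from one scale to the next. Call q good if H q >= h q. If a good prime
   q > tower i divides p - 1, then appending p to a chain ending at q gives
   H p > H q >= h q, and this is at least h p - g p as soon as p lies at most
   about g p / K scales above q. Hence for an exceptional p <= x no good prime
   of the last J = g x / K scales divides p - 1. The good primes have relative
   density c, so by partial summation their reciprocals over these scales add
   up to c * J * ln 2 + O(1), and an upper-bound sieve (Brun-Hooley) on the
   integers p, avoiding 0 modulo small primes and 1 modulo good ones, loses
   the factor exp (- c * J * ln 2) against the number of primes. *)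

Require Import Defs.
From mathcomp Require Import all_boot all_order all_algebra.
From mathcomp Require Import all_classical all_reals all_analysis.
From mathcomp Require Import ring lra zify.

Set Implicit Arguments.
Unset Strict Implicit.
Unset Printing Implicit Defensive.

Import Order.TTheory GRing.Theory Num.Theory.
Import numFieldNormedType.Exports.
Local Open Scope classical_set_scope.
Local Open Scope ring_scope.

(** The constant may not depend on [K], [c], [g], [h], while every scale of good primes missed by
    the sieve costs a factor of about [2 ^ c]; so only an absolutely bounded number of scales may be
    lost. Hence the sifting primes must go up to [tower (n - 4)], a fixed power of the size of [p].
    Truncating inclusion-exclusion separately in each block makes this possible with nothing but the
    trivial count of integers in residue classes. The second obstacle is the threshold beyond which
    good primes are known to be dense, which depends on all the data. For bounded [g] the last [J]
    scales eventually lie above it. An unbounded [g] may gain as much as [K] at every scale, so that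
    these scales reach below the threshold and the loss is no longer absolute. That case is won by
    first obtaining a density greater than [c]: the gain is proportional to [g] and overtakes any
    fixed loss. *)

(** * Primorial bound and Mertens' first theorem *)

Lemma prod_primes_dvdn (s : seq nat) m : uniq s ->
  {in s, forall p, prime p && (p %| m)%N} -> (\prod_(p <- s) p %| m)%N.
Proof.
elim: s => [|p s IHs] /=; first by rewrite big_nil dvd1n.
case/andP=> pNs us sm; rewrite big_cons.
have /andP[pp pm] := sm p (mem_head _ _).
have cop : coprime p (\prod_(q <- s) q).
  rewrite big_seq; apply: (big_ind (fun x => coprime p x)) => [|x y|q qs].
  - exact: coprimen1.
  - by rewrite coprimeMr => -> ->.
  have /andP[pq _] := sm q (mem_behead (s := p :: s) qs).
  rewrite prime_coprime // dvdn_prime2 //.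
  by apply: contraNneq pNs => ->.
rewrite Gauss_dvd // pm IHs // => q qs.
by apply: sm; rewrite inE qs orbT.
Qed.

Lemma bin_mid_le m : ('C(m.*2.+1, m) <= 4 ^ m)%N.
Proof.
have sym : 'C(m.*2.+1, m) = 'C(m.*2.+1, m.+1).
  rewrite -[in RHS]bin_sub; last by rewrite -addnn ltnS leq_addr.
  by congr 'C(_, _); lia.
have : ('C(m.*2.+1, m) + 'C(m.*2.+1, m.+1) <= 2 ^ m.*2.+1)%N.
  rewrite -[2%N]/(1 + 1)%N expnDn.
  have lt1 : (m < m.*2.+2)%N by rewrite -addnn; lia.
  have lt2 : (m.+1 < m.*2.+2)%N by lia.
  rewrite (bigD1 (Ordinal lt1)) //= (bigD1 (Ordinal lt2)) //=; last first.
    by rewrite -val_eqE /= eqn_leq ltnn.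
  by rewrite !exp1n !muln1 addnA leq_addr.
by rewrite -sym expnS -mul2n expnM addnn -mul2n leq_pmul2l.
Qed.

(** Erdos's argument, by strong induction: an even [n > 2] is not prime, and for [n = 2m + 1] the
    primes in [(m + 1, 2m + 1]] all divide ['C(2m + 1, m)], which is at most [4 ^ m]. *)
Lemma primorial_le n : (\prod_(0 <= p < n.+1 | prime p) p <= 4 ^ n)%N.
Proof.
elim/ltn_ind: n => n IHn; case: (ltnP n 3) => [|n3].
  by case: n IHn => [|[|[|]]] // _ _; rewrite unlock /=.
have [no|ne] := boolP (odd n); last first.
  have nNp : prime n = false.
    by apply: contraNF ne => pn; case: (even_prime pn) => // n2; lia.
  case: n IHn n3 {ne} nNp => // n IHn _ nNp.
  rewrite big_mkcond big_nat_recr //= nNp muln1 -big_mkcond.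
  by apply: leq_trans (IHn _ _) _ => //; rewrite leq_exp2l.
pose m := n./2; have nE : n = m.*2.+1 by rewrite -[LHS]odd_double_half no.
have m0 : (0 < m)%N by lia.
rewrite nE (big_cat_nat (n := m.+2)) //=; last by lia.
have -> : m.*2.+1 = (m.+1 + m)%N by lia.
rewrite expnD leq_mul ?IHn //; first by lia.
have -> : (m.+1 + m)%N = m.*2.+1 by lia.
apply: leq_trans (bin_mid_le m); apply: dvdn_leq.
  by rewrite bin_gt0; lia.
rewrite -big_filter; apply: prod_primes_dvdn.
  by rewrite filter_uniq ?iota_uniq.
move=> p; rewrite mem_filter mem_index_iota => /andP[pp /andP[mp pm]].
rewrite pp /=.
have fact_ndvd k : (k < p)%N -> coprime p k`!.
  move=> kp; rewrite prime_coprime //; apply/negP => pk.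
  have : (0 < logn p k`!)%N by rewrite logn_gt0 mem_primes pp fact_gt0.
  rewrite logn_fact // big_nat big1 // => i /andP[i0 _].
  apply: divn_small; apply: leq_trans kp _.
  by rewrite -[leqLHS]expn1 leq_pexp2l // prime_gt0.
have le1 : (m <= m.*2.+1)%N by lia.
rewrite -(Gauss_dvdl _ (p := (m`! * (m.*2.+1 - m)`!)%N)).
  by rewrite bin_fact // dvdn_fact // prime_gt0 //; lia.
by rewrite coprimeMr !fact_ndvd //; lia.
Qed.
Section Mertens.
Variable R : realType.
Implicit Types (n m : nat) (x : R).

Lemma natr_gt0 n : (0 < n)%N -> 0 < n%:R :> R.
Proof. by rewrite ltr0n. Qed.

Lemma ln_nat_ge0 n : 0 <= ln n%:R :> R.
Proof. by case: n => [|n]; [rewrite ln0 | rewrite ln_ge0 // ler1n]. Qed.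

Lemma ln_prod_nat (r : seq nat) (P : pred nat) (F : nat -> nat) :
  (forall i, P i -> (0 < F i)%N) ->
  ln (\prod_(i <- r | P i) F i)%N%:R = \sum_(i <- r | P i) ln (F i)%:R :> R.
Proof.
move=> F0; elim: r => [|i r IHr]; first by rewrite !big_nil ln1.
rewrite !big_cons; case: ifP => // Pi.
rewrite natrM lnM ?IHr // posrE natr_gt0 ?F0 //.
by rewrite prodn_cond_gt0.
Qed.

Lemma ln_fact n : ln n`!%:R =
  \sum_(0 <= p < n.+1 | prime p) (logn p n`!)%:R * ln p%:R :> R.
Proof.
have E : n`! = (\prod_(0 <= p < n.+1 | prime p) p ^ logn p n`!)%N.
  rewrite -[LHS](partnT (fact_gt0 n)) /partn.
  have le_n : (n.+1 <= n`!.+1)%N.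
    by rewrite ltnS; elim: n => // n IHn; rewrite factS; have := fact_gt0 n; nia.
  rewrite (big_cat_nat (n := n.+1)) //= [X in (_ * X)%N]big1_seq ?muln1.
    rewrite [RHS]big_mkcond; apply: eq_bigr => p _.
    by case: ifPn => // pNp; rewrite lognE (negPf pNp).
  move=> p; rewrite mem_index_iota => /andP[_ /andP[np _]].
  have [pp|pNp] := boolP (prime p); last by rewrite lognE (negPf pNp).
  rewrite logn_fact // big_nat big1 // => i /andP[i0 _].
  apply: divn_small; apply: leq_trans np _.
  by rewrite -[leqLHS]expn1 leq_pexp2l // prime_gt0.
rewrite [in LHS]E ln_prod_nat => [|p pp]; last by rewrite expn_gt0 prime_gt0.
apply: eq_bigr => p pp; rewrite natrX lnXn ?mulr_natl //.
by rewrite natr_gt0 // prime_gt0.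
Qed.

Lemma chebyshev_theta_le n :
  \sum_(0 <= p < n.+1 | prime p) ln p%:R <= n%:R * ln 4 :> R.
Proof.
rewrite -ln_prod_nat => [|p /prime_gt0 //].
rewrite mulr_natl -lnXn // -natrX ler_ln ?posrE ?natr_gt0 ?expn_gt0 //.
  by rewrite ler_nat primorial_le.
by rewrite prodn_cond_gt0 // => p /prime_gt0.
Qed.

Lemma ln_fact_le n : ln n`!%:R <= n%:R * ln n%:R :> R.
Proof.
elim: n => [|n IHn]; first by rewrite mul0r fact0 ln1.
rewrite factS natrM lnM ?posrE ?natr_gt0 ?fact_gt0 //.
set l := ln n.+1%:R; rewrite -natr1 mulrDl mul1r addrC lerD2r {}/l.
apply: le_trans IHn _; rewrite ler_wpM2l //.
case: n => [|n]; first by rewrite ln0 // ln_nat_ge0.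
by rewrite ler_ln ?posrE ?natr_gt0 // ler_nat.
Qed.

(** A single term of the series of [expR n%:R] is already at most the sum. *)
Lemma ln_fact_ge n : n%:R * ln n%:R - n%:R <= ln n`!%:R :> R.
Proof.
case: n => [|n]; first by rewrite mul0r subr0 fact0 ln1.
have := expR_ge1Dxn n (ler0n R n.+1).
move=> le1; have {le1} : n.+1%:R ^+ n.+1 <= expR n.+1%:R * n.+1`!%:R :> R.
  by rewrite -ler_pdivrMr ?natr_gt0 ?fact_gt0 //; lra.
rewrite -ler_ln ?posrE ?exprn_gt0 ?mulr_gt0 ?expR_gt0 ?natr_gt0 ?fact_gt0 //.
rewrite lnM ?posrE ?expR_gt0 ?natr_gt0 ?fact_gt0 // expRK lnXn ?natr_gt0 //.
by rewrite mulr_natl; lra.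
Qed.

(** By Legendre's formula the exponent of [p] in the factorial of [n] exceeds [n / p - 1];
    Chebyshev's bound pays for the [- 1]. *)
Lemma sum_ln_prime_le n : (0 < n)%N ->
  \sum_(0 <= p < n.+1 | prime p) ln p%:R / p%:R <= ln n%:R + ln 4 :> R.
Proof.
move=> n0; rewrite -(ler_pM2l (natr_gt0 n0)) mulrDr.
apply: le_trans (lerD (ln_fact_le n) (chebyshev_theta_le n)).
rewrite ln_fact -big_split mulr_sumr /=; apply: ler_sum => p pp.
have p0 : 0 < p%:R :> R by rewrite natr_gt0 // prime_gt0.
suff : n%:R / p%:R <= (logn p n`!)%:R + 1 :> R.
  by have := ln_nat_ge0 p; nra.
rewrite ler_pdivrMr // natr1 -natrM ler_nat.
apply: leq_trans (ltnW (ltn_ceil n (prime_gt0 pp))) _.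
rewrite leq_mul2r ltnS logn_fact //; apply/orP; right.
by rewrite big_ltn // expn1 leq_addr.
Qed.

Lemma logn_fact_le p n : prime p -> (logn p n`!)%:R <= n%:R / (p%:R - 1) :> R.
Proof.
move=> pp; have p1 : 1 < p%:R :> R by rewrite ltr1n prime_gt1.
rewrite ler_pdivlMr ?subr_gt0 // logn_fact // natr_sum.
suff H m : (\sum_(1 <= k < m.+1) (n %/ p ^ k)%N%:R) * (p%:R - 1)
    <= n%:R - n%:R / p%:R ^+ m :> R.
  by apply: le_trans (H n) _; rewrite gerBl divr_ge0 // exprn_ge0.
elim: m => [|m IHm]; first by rewrite big_geq // mul0r expr0 divr1 subrr.
rewrite big_nat_recr //= mulrDl.
have pm : 0 < p%:R ^+ m.+1 :> R by rewrite exprn_gt0 //; lra.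
have : (n %/ p ^ m.+1)%N%:R <= n%:R / p%:R ^+ m.+1 :> R.
  by rewrite ler_pdivlMr // -natrX -natrM ler_nat leq_trunc_div.
have E : n%:R / p%:R ^+ m = p%:R * (n%:R / p%:R ^+ m.+1) :> R.
  by rewrite exprS; field; rewrite expf_neq0 //=; lra.
rewrite {}E in IHm; set y := n%:R / _ in IHm *; nra.
Qed.

Lemma sum_ln_over_pronic n :
  \sum_(2 <= k < n.+1) ln k%:R / (k%:R * (k%:R - 1)) <= 2 :> R.
Proof.
(* An antiderivative of [ln x / x ^ 2] is [- (ln x + 1) / x]; taking [2] in place of [1] leaves the
   slack that the discrete telescoping needs. *)
suff H m : \sum_(2 <= k < m.+2) ln k%:R / (k%:R * (k%:R - 1))
    <= 2 - (ln m.+1%:R + 2) / m.+1%:R :> R.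
  case: n => [|n]; first by rewrite big_geq.
  apply: le_trans (H n) _; rewrite gerBl divr_ge0 // addr_ge0 //.
  exact: ln_nat_ge0.
elim: m => [|m IHm]; first by rewrite big_geq // ln1 divr1; lra.
rewrite big_nat_recr //= -lerBrDr; apply: le_trans IHm _.
have k0 : 0 < m.+1%:R :> R by rewrite natr_gt0.
rewrite -[m.+2%:R]natr1; set k := m.+1%:R in k0 *.
have k1 : 1 <= k by rewrite /k ler1n.
have : ln (1 + k^-1) <= k^-1 by apply: le_ln1Dx; rewrite (lt_trans _ (_ : 0 < k^-1)) ?invr_gt0 //; lra.
have -> : 1 + k^-1 = (k + 1) / k by field; lra.
rewrite ln_div ?posrE //; last by lra.
rewrite -(ler_pM2r k0) mulVf; last by lra.
set a := ln k; set b := ln _ => ab.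
rewrite -subr_ge0.
have -> : 2 - (b + 2) / (k + 1) - b / ((k + 1) * (k + 1 - 1)) - (2 - (a + 2) / k)
   = ((k + 1) * (a - b) + 2) / (k * (k + 1)) by field; lra.
by rewrite divr_ge0 //; nra.
Qed.

(** Of the loss [3], Stirling's lower bound takes [1], and replacing [1 / (p - 1)] by [1 / p] takes
    [2]. *)
Lemma sum_ln_prime_ge n : (0 < n)%N ->
  ln n%:R - 3 <= \sum_(0 <= p < n.+1 | prime p) ln p%:R / p%:R :> R.
Proof.
move=> n0; have n0R := natr_gt0 n0.
have le1 : ln n%:R - 1 <= \sum_(0 <= p < n.+1 | prime p) ln p%:R / (p%:R - 1) :> R.
  rewrite -(ler_pM2l n0R) mulrBr mulr1; apply: le_trans (ln_fact_ge n) _.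
  rewrite ln_fact mulr_sumr; apply: ler_sum => p pp.
  rewrite mulrA mulrAC ler_wpM2r ?ln_nat_ge0 //.
  exact: logn_fact_le.
have : \sum_(0 <= p < n.+1 | prime p) ln p%:R / (p%:R - 1)
     - \sum_(0 <= p < n.+1 | prime p) ln p%:R / p%:R <= 2 :> R.
  apply: le_trans (sum_ln_over_pronic n); rewrite -sumrB.
  case: n n0 {n0R le1} => // n _; rewrite big_mkcond big_ltn // big_ltn //= !add0r.
  apply: ler_sum_nat => k /andP[k2 _].
  have k1 : 2 <= k%:R :> R by rewrite ler_nat.
  have := ln_nat_ge0 k; case: ifP => _ lnk.
    by rewrite le_eqVlt; apply/orP; left; apply/eqP; field; apply/andP; split; lra.
  by rewrite divr_ge0 // mulr_ge0 //; lra.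
by lra.
Qed.

End Mertens.

(** * Doubly exponential scales; Mertens' second theorem and prime counts *)

Definition tower i := (2 ^ (2 ^ i))%N.

Lemma towerS i : tower i.+1 = (tower i ^ 2)%N.
Proof. by rewrite /tower expnSr expnM. Qed.

Lemma tower_gt0 i : (0 < tower i)%N.
Proof. by rewrite expn_gt0. Qed.

Lemma leq_tower i j : (tower i <= tower j)%N = (i <= j)%N.
Proof. by rewrite !leq_exp2l. Qed.

Lemma tower_ge2 i : (2 <= tower i)%N.
Proof. by rewrite -[2%N]/(tower 0) leq_tower. Qed.

Section PrimeSums.
Variable R : realType.
Implicit Types (n m : nat) (x : R) (P Q : pred nat).

Lemma abel_ge (f w : nat -> R) (M : R) m n : (m <= n)%N -> 0 <= M ->
  (forall k, (m <= k)%N -> 0 <= w k) ->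
  (forall k, (m <= k)%N -> w k.+1 <= w k) ->
  (forall k, (m <= k)%N -> - M <= \sum_(m <= i < k) f i) ->
  - (M * w m) <= \sum_(m <= i < n) f i * w i.
Proof.
move=> mn M0 w0 wS fM.
(* Abel summation turned into an inductive invariant: the current partial sum, shifted by [M] to be
   nonnegative, is kept with the current weight, which can only decrease. *)
suff : (\sum_(m <= i < n) f i + M) * w n - M * w m <= \sum_(m <= i < n) f i * w i.
  by have := w0 n mn; have := fM n mn; nra.
elim: n mn => [|n IHn] mn.
  by move: mn; rewrite leqn0 => /eqP->; rewrite !big_geq //; lra.
move: mn; rewrite leq_eqVlt => /orP[/eqP->|]; first by rewrite !big_geq //; lra.
rewrite ltnS => mn; have := IHn mn; have := wS n mn; have := w0 n mn.
have := fM n.+1 (leqW mn); rewrite !big_nat_recr //=.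
set s := \sum_(_ <= _ < _) _; set t := \sum_(_ <= _ < _) _; nra.
Qed.

Definition recip_primes n : R := \sum_(0 <= p < n.+1 | prime p) p%:R^-1.

Definition cnt P n : R := \sum_(0 <= p < n.+1 | prime p && P p) 1.

Lemma sum_primes_from2 (F : nat -> R) n : (0 < n)%N ->
  \sum_(0 <= p < n.+1 | prime p) F p = \sum_(2 <= p < n.+1) if prime p then F p else 0.
Proof.
by move=> n0; rewrite big_mkcond /= big_ltn // big_ltn //= !add0r.
Qed.

Lemma sum_primes_from3 (F : nat -> R) n : (2 <= n)%N ->
  \sum_(0 <= p < n.+1 | prime p) F p =
    F 2%N + \sum_(3 <= p < n.+1) if prime p then F p else 0.
Proof.
move=> n2; have n0 : (0 < n)%N by exact: ltnW.
by rewrite sum_primes_from2 // big_ltn //=.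
Qed.

Lemma ln2_ge : 1 / 2 <= ln 2 :> R.
Proof.
have : ln (1 + - (1 / 2)) <= - (1 / 2) :> R by apply: le_ln1Dx; lra.
have -> : 1 + - (1 / 2) = 2^-1 :> R by lra.
by rewrite lnV ?posrE //; lra.
Qed.

Lemma ln4 : ln 4 = 2 * ln 2 :> R.
Proof. by rewrite -[4]/((2 * 2)%N%:R) natrM lnM ?posrE // mulr_natl. Qed.

Lemma ln_nat_gt0 n : (2 <= n)%N -> 0 < ln n%:R :> R.
Proof. by move=> n2; rewrite ln_gt0 // ltr1n. Qed.

Lemma ler_ln_nat m n : (0 < m)%N -> (m <= n)%N -> ln m%:R <= ln n%:R :> R.
Proof.
by move=> m0 mn; rewrite ler_ln ?posrE ?ltr0n ?(leq_trans m0) // ler_nat.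
Qed.

Lemma lnln_sub_le (x y : R) : 0 < x -> 0 < y -> ln x - ln y <= (x - y) / y.
Proof.
move=> x0 y0; rewrite -ln_div ?posrE //.
have -> : x / y = 1 + (x - y) / y by field; lra.
by apply: le_ln1Dx; rewrite ltr_pdivlMr //; lra.
Qed.

(** Abel summation with weight [1 / ln p] compares the primes with the forward increments of [ln].
    After weighting, these increments dominate those of [ln (ln p)]. The partial sums never fall
    below [- 3], and [3 / ln 2 <= 6]. *)
Lemma recip_primes_ge n : (2 <= n)%N ->
  ln (ln n%:R) - ln (ln 2) - 6 <= recip_primes n.
Proof.
move=> n2; pose f p := (if prime p then ln p%:R / p%:R else 0)
  - (ln p.+1%:R - ln p%:R) : R.
have l2 := ln2_ge.
have := @abel_ge f (fun p => (ln p%:R)^-1) 3 2 n.+1 (leqW n2) (ler0n R 3).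
have h1 k : (2 <= k)%N -> 0 <= (ln k%:R)^-1 :> R.
  by move=> /ln_nat_gt0/ltW; rewrite invr_ge0.
have h2 k : (2 <= k)%N -> (ln k.+1%:R)^-1 <= (ln k%:R)^-1 :> R.
  move=> k2; rewrite lef_pV2 ?posrE ?ln_nat_gt0 //; last exact: leqW.
  by rewrite ler_ln_nat // (leq_trans _ k2).
have h3 k : (2 <= k)%N -> - 3 <= \sum_(2 <= i < k) f i.
  case: k => // k k1; rewrite sumrB -big_mkcond telescope_sumr //=.
  have k0 : (0 < k)%N by lia.
  have := sum_ln_prime_ge R k0.
  rewrite sum_primes_from2 // -big_mkcond /=.
  have : ln k.+1%:R <= ln k%:R + ln 2 :> R.
    rewrite -lnM ?posrE ?ltr0n // -natrM ler_ln_nat //; lia.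
  by set s := \sum_(_ <= _ < _ | _) _; lra.
move=> /(_ h1 h2 h3) abel.
have : \sum_(2 <= i < n.+1) f i * (ln i%:R)^-1
    <= recip_primes n - (ln (ln n.+1%:R) - ln (ln 2)).
  rewrite -(@telescope_sumr _ _ _ (fun k => ln (ln k%:R))) ?leqW //.
  rewrite /recip_primes sum_primes_from2 ?(ltnW n2) // -sumrB; apply: ler_sum_nat => k /andP[k2 _].
  have lk := ln_nat_gt0 k2; have lk1 := ln_nat_gt0 (leqW k2).
  rewrite /f mulrBl lerB //; last exact: lnln_sub_le.
  case: ifP => _; last by rewrite mul0r.
  by rewrite mulrAC divff ?mul1r //; lra.
have : ln (ln n%:R) <= ln (ln n.+1%:R) :> R.
  by rewrite ler_ln ?posrE ?ln_nat_gt0 ?ler_ln_nat ?leqW //; lia.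
have : 3 * (ln 2)^-1 <= 6 :> R by rewrite ler_pdivrMr //; lra.
lra.
Qed.

(** The mirror image with backward increments, which after weighting are dominated by those of
    [ln (ln p)]. The sum starts at [3] because at [2] the increment would involve [ln (ln 1)]. *)
Lemma recip_primes_le n : (2 <= n)%N ->
  recip_primes n <= ln (ln n%:R) - ln (ln 2) + 6.
Proof.
move=> n2; pose f p := (ln p%:R - ln p.-1%:R)
  - (if prime p then ln p%:R / p%:R else 0) : R.
have l2 := ln2_ge.
have M0 : 0 <= 3 * ln 2 :> R by lra.
have := @abel_ge f (fun p => (ln p%:R)^-1) (3 * ln 2) 3 n.+1 n2 M0.
have h1 k : (3 <= k)%N -> 0 <= (ln k%:R)^-1 :> R.
  by move=> k3; rewrite invr_ge0 ltW // ln_nat_gt0 // ltnW.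
have h2 k : (3 <= k)%N -> (ln k.+1%:R)^-1 <= (ln k%:R)^-1 :> R.
  move=> k3; rewrite lef_pV2 ?posrE ?ln_nat_gt0 //; try lia.
  by rewrite ler_ln_nat //; lia.
have tel k (F : nat -> R) : (3 <= k)%N ->
    \sum_(3 <= i < k) (F i - F i.-1) = F k.-1 - F 2%N.
  by case: k => // k k3; rewrite big_add1 telescope_sumr.
have h3 k : (3 <= k)%N -> - (3 * ln 2) <= \sum_(3 <= i < k) f i.
  move=> k3; rewrite sumrB (tel k (fun i => ln i%:R)) // -big_mkcond.
  have k0 : (0 < k.-1)%N by lia.
  have := sum_ln_prime_le R k0; rewrite sum_primes_from3; last by lia.
  rewrite prednK -?big_mkcond /=; last by lia.
  rewrite ln4.
  set s := \sum_(_ <= _ < _ | _) _.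
  lra.
move=> /(_ h1 h2 h3) abel.
have : \sum_(3 <= i < n.+1) f i * (ln i%:R)^-1
    <= (ln (ln n%:R) - ln (ln 2)) - (recip_primes n - 2^-1).
  rewrite -(tel n.+1 (fun k => ln (ln k%:R))) //.
  rewrite /recip_primes sum_primes_from3 // addrAC subrr add0r -sumrB; apply: ler_sum_nat => k /andP[k3 _].
  have lk : 0 < ln k%:R :> R by rewrite ln_nat_gt0 // ltnW.
  have lk1 : 0 < ln k.-1%:R :> R by rewrite ln_nat_gt0 //; lia.
  rewrite /f mulrBl lerB //.
    have := lnln_sub_le lk1 lk.
    by rewrite mulrBl mulrBl; lra.
  case: ifP => _; last by rewrite mul0r.
  by rewrite mulrAC divff ?mul1r //; lra.
have : 3 * ln 2 * (ln 3%:R)^-1 <= 3 :> R.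
  rewrite ler_pdivrMr ?ln_nat_gt0 // ler_wpM2l //.
  exact: (@ler_ln_nat 2 3).
lra.
Qed.

Lemma ln_tower i : ln (tower i)%:R = 2 ^+ i * ln 2 :> R.
Proof. by rewrite /tower natrX lnXn // -[LHS]mulr_natl natrX. Qed.

Lemma lnln_tower i : ln (ln (tower i)%:R) - ln (ln 2) = i%:R * ln 2 :> R.
Proof.
have l2 := ln2_ge; rewrite ln_tower lnM ?posrE ?exprn_gt0 //; last by lra.
by rewrite addrK lnXn // mulr_natl.
Qed.

Lemma recip_primes_tower i :
  i%:R * ln 2 - 6 <= recip_primes (tower i) <= i%:R * ln 2 + 6.
Proof.
have := recip_primes_ge (tower_ge2 i); have := recip_primes_le (tower_ge2 i).
by rewrite lnln_tower => -> ->.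
Qed.

Lemma cnt_ge1 n : (2 <= n)%N -> 1 <= cnt predT n.
Proof.
move=> n2; rewrite /cnt (eq_bigl prime) => [|p]; last by rewrite andbT.
by rewrite sum_primes_from3 // lerDl sumr_ge0 // => i _; case: ifP.
Qed.

(** The two Mertens bounds leave the primes in [(n / 2 ^ 10, n]] a mass of [ln p / p] of at least
    [10 ln 2 - 2 ln 2 - 3 >= 1], and each term there is at most [2 ^ 10 * ln n / n]. The further
    factor [2] covers [n < 2 ^ 10], where [ln n >= 1 / 2] is used. *)
Lemma prime_count_ge n : (2 <= n)%N ->
  n%:R <= 2 ^+ 11 * (ln n%:R * cnt predT n).
Proof.
move=> n2; have l2 := ln2_ge; have ln0 := ln_nat_gt0 n2.
have n0 : 0 < n%:R :> R by rewrite ltr0n; lia.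
have [B EB] : exists B, B = (2 ^ 10)%N by eexists.
have BR : 2 ^+ 10 = B%:R :> R by rewrite EB natrX.
have B0 : (0 < B)%N by rewrite EB expn_gt0.
rewrite exprS {}BR.
have [nB|Bn] := ltnP n B.
  have : n%:R <= B%:R :> R by rewrite ler_nat ltnW.
  have := cnt_ge1 n2; have := ler_ln_nat (isT : (0 < 2)%N) n2.
  move=> l1 c1 nB'; have : 1 / 2 <= ln n%:R * cnt predT n by nra.
  have : 0 <= B%:R :> R by [].
  nra.
pose m := (n %/ B)%N; have m0 : (0 < m)%N by rewrite divn_gt0.
have mn : (m <= n)%N by rewrite leq_div.
have := sum_ln_prime_ge R (leq_trans m0 mn); have := sum_ln_prime_le R m0.
rewrite ln4.
have : ln m%:R + 10 * ln 2 <= ln n%:R :> R.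
  have -> : 10 * ln 2 = ln (2 ^+ 10) :> R by rewrite lnXn // mulr_natl.
  rewrite -natrX -EB -lnM ?posrE ?ltr0n // -natrM ler_ln_nat ?muln_gt0 ?m0 //.
  exact: leq_trunc_div.
rewrite (big_cat_nat (n := m.+1) (p := n.+1)) //=.
set s := \sum_(0 <= _ < _ | _) _; set t := \sum_(_.+1 <= _ < _ | _) _ => e1 e2 e3.
have {e1 e2 e3} t1 : 1 <= t by lra.
have : t <= B%:R * ln n%:R / n%:R * cnt predT n.
  rewrite /cnt (big_cat_nat (n := m.+1)) //= mulrDr.
  have q0 : 0 <= B%:R * ln n%:R / n%:R :> R.
    by rewrite divr_ge0 // mulr_ge0 // ltW.
  rewrite -[leLHS]add0r; apply: lerD; first by rewrite mulr_ge0 ?sumr_ge0.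
  rewrite mulr_sumr /t big_nat_cond [leRHS]big_nat_cond.
  rewrite [leRHS](eq_bigl (fun i => (m < i < n.+1)%N && prime i)); last first.
    by move=> i; rewrite andbT.
  apply: ler_sum => p /andP[/andP[mp pn] pp]; rewrite mulr1.
  have p0 : 0 < p%:R :> R by rewrite ltr0n prime_gt0.
  rewrite ler_pdivrMr // mulrAC ler_pdivlMr //.
  have : ln p%:R <= ln n%:R :> R by rewrite ler_ln_nat ?prime_gt0.
  have : n%:R <= B%:R * p%:R :> R.
    rewrite -natrM ler_nat; have := ltn_ceil n B0; rewrite -/m; lia.
  have := ln_nat_ge0 R p; nra.
move=> tle; have := le_trans t1 tle; rewrite mulrAC ler_pdivlMr // mul1r.
have : 0 <= ln n%:R * cnt predT n by rewrite mulr_ge0 ?sumr_ge0 ?ltW.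
lra.
Qed.

Lemma cnt_le P n : cnt P n <= n%:R.
Proof.
rewrite /cnt big_mkcond big_ltn //= add0r -[leRHS]mulr1.
have -> : n%:R * 1 = \sum_(1 <= p < n.+1) 1 :> R.
  by rewrite sumr_const_nat subn1 mulr_natl.
by apply: ler_sum => p _; case: ifP.
Qed.

(** Abel summation for the indicator of [Q] minus [c] times that of the primes. Past [a] the partial
    sums are at least [- a], and the first weight is [1 / (a + 1)]: the loss is [1] however large
    the threshold [a] is. *)
Lemma density_sum_recip Q (c : R) a b : (a <= b)%N -> 0 <= c ->
  (forall n, (a <= n)%N -> c * cnt predT n <= cnt Q n) ->
  c * (recip_primes b - recip_primes a) - 1 <=
    \sum_(a.+1 <= p < b.+1 | prime p && Q p) p%:R^-1.
Proof.
move=> ab c0 dQ; pose f p : R := (prime p && Q p)%:R - c * (prime p)%:R.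
have fE k : (a.+1 <= k)%N -> \sum_(a.+1 <= i < k) f i =
    (cnt Q k.-1 - c * cnt predT k.-1) - (cnt Q a - c * cnt predT a).
  case: k => // k; rewrite ltnS => ak /=.
  have E P : cnt P k = cnt P a + \sum_(a.+1 <= p < k.+1 | prime p && P p) 1.
    by rewrite /cnt (big_cat_nat (n := a.+1)).
  rewrite sumrB -mulr_sumr !E.
  rewrite (big_mkcond (fun p => _ && Q p)) (big_mkcond (fun p => _ && predT p)) /=.
  have -> : \sum_(a.+1 <= p < k.+1) (prime p && Q p)%:R =
      \sum_(a.+1 <= p < k.+1) if prime p && Q p then 1 else 0 :> R.
    by apply: eq_bigr => p _; case: ifP.
  have -> : \sum_(a.+1 <= p < k.+1) (prime p)%:R =
      \sum_(a.+1 <= p < k.+1) if prime p && predT p then 1 else 0 :> R.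
    by apply: eq_bigr => p _; rewrite andbT; case: ifP.
  lra.
have := @abel_ge f (fun p => p%:R^-1) a%:R a.+1 b.+1 ab (ler0n _ _).
have h1 k : (a.+1 <= k)%N -> 0 <= k%:R^-1 :> R by rewrite invr_ge0.
have h2 k : (a.+1 <= k)%N -> k.+1%:R^-1 <= k%:R^-1 :> R.
  by move=> ak; rewrite lef_pV2 ?posrE ?ltr0n ?ler_nat // (leq_trans _ ak).
have h3 k : (a.+1 <= k)%N -> - a%:R <= \sum_(a.+1 <= i < k) f i.
  move=> ak; rewrite fE //.
  have ak1 : (a <= k.-1)%N by lia.
  have := dQ _ ak1; have := cnt_le Q a.
  have : 0 <= c * cnt predT a by rewrite mulr_ge0 ?sumr_ge0.
  lra.
move=> /(_ h1 h2 h3) /= abel.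
have a1 : a%:R * a.+1%:R^-1 <= 1 :> R.
  by rewrite ler_pdivrMr ?ltr0n // mul1r ler_nat.
suff : \sum_(a.+1 <= i < b.+1) f i * i%:R^-1 =
    \sum_(a.+1 <= p < b.+1 | prime p && Q p) p%:R^-1
    - c * (recip_primes b - recip_primes a).
  move=> E; rewrite E in abel.
  by move: abel a1; set y := a%:R * _; set z := c * _; lra.
have -> : recip_primes b - recip_primes a =
    \sum_(a.+1 <= p < b.+1 | prime p) p%:R^-1.
  by apply/eqP; rewrite subr_eq addrC; apply/eqP; exact: big_cat_nat.
rewrite [in RHS]big_mkcond (big_mkcond prime) mulr_sumr -sumrB.
apply: eq_bigr => p _; rewrite /f; case: (prime p) => /=.
  by case: (Q p); rewrite ?mulr0n ?mulr1n; lra.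
by rewrite !mulr0 subrr mul0r.
Qed.

End PrimeSums.

(** * Truncated inclusion-exclusion and equidistribution in residue classes *)

Section Sieve.
Variable R : realType.
Implicit Types (n m p q r D N : nat) (x S M W : R) (s : seq nat) (F G : nat -> R).

(* The truncated inclusion-exclusion sum
   \sum_(d <= m) (-1)^d e_d(s), with e_d the elementary symmetric functions. *)
Fixpoint tau (xs : seq R) m : R :=
  if xs is x :: xs' then
    if m is m'.+1 then tau xs' m - x * tau xs' m' else 1
  else 1.

Lemma tau0 xs : tau xs 0 = 1.
Proof. by case: xs. Qed.

Lemma prod_1B_itv (xs : seq R) : all (fun x => 0 <= x <= 1) xs ->
  0 <= \prod_(x <- xs) (1 - x) <= 1.
Proof.
elim: xs => [|x xs IHxs]; first by rewrite big_nil lexx ler01.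
move=> /= /andP[x01 /IHxs]; rewrite big_cons; set t := \prod_(_ <- _) _ => t01.
by apply/andP; split; nra.
Qed.

(** In the recursion for [tau] the two terms have orders of opposite parity and opposite signs, so
    their errors point the same way. *)
Lemma bonferroni xs m : all (fun x => 0 <= x <= 1) xs ->
  if odd m then tau xs m <= \prod_(x <- xs) (1 - x)
  else \prod_(x <- xs) (1 - x) <= tau xs m.
Proof.
elim: xs m => [|x xs IHxs] m; first by rewrite !big_nil; case: ifP.
case: m => [h|m]; first by rewrite tau0; case/andP: (prod_1B_itv h).
move=> /= /andP[x01 h]; rewrite big_cons.
have := IHxs m h; have := IHxs m.+1 h; rewrite /=.
by case: (odd m) => /=; nra.
Qed.

Lemma exprD_ge2 x S k : 0 <= x -> 0 <= S ->
  S ^+ k.+1 + k.+1%:R * x * S ^+ k <= (S + x) ^+ k.+1.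
Proof.
move=> x0 S0; elim: k => [|k IHk]; first by rewrite !expr1 expr0; lra.
have Sx : 0 <= S + x by lra.
rewrite [leRHS]exprS; apply: le_trans (ler_wpM2l Sx IHk).
have : 0 <= k.+1%:R * x * x * S ^+ k by rewrite !mulr_ge0 ?exprn_ge0.
rewrite -[k.+2%:R]natr1 ![S ^+ _.+1]exprS.
set a := S ^+ k; set b := k.+1%:R; nra.
Qed.

(** The error obeys the recursion of [tau] itself; the bound propagates because [exprD_ge2] keeps
    the first two terms of the binomial expansion of [(S + x) ^ (m + 2)]. *)
Lemma tau_approx xs m : all (fun x => 0 <= x <= 1) xs ->
  `|tau xs m - \prod_(x <- xs) (1 - x)| <= (\sum_(x <- xs) x) ^+ m.+1 / m.+1`!%:R.
Proof.
elim: xs m => [|x xs IHxs] m h.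
  by rewrite !big_nil subrr normr0 divr_ge0 // exprn_ge0.
have := prod_1B_itv h.
move: h => /= /andP[/andP[x0 x1] h]; rewrite !big_cons.
have S0 : 0 <= \sum_(y <- xs) y.
  by move/allP: h => h; rewrite big_seq sumr_ge0 // => y /h /andP[].
have := prod_1B_itv h; move: S0 (IHxs ^~ h).
set S := \sum_(_ <- _) _; set T := \prod_(_ <- _) _ => S0 IH T01 xT01.
case: m => [|m].
  have := IH 0%N; rewrite tau0 !expr1 !divr1.
  case/andP: T01 xT01 => T0 T1 /andP[xT0 xT1].
  have xT : 0 <= x * (1 - T) by rewrite mulr_ge0 //; lra.
  by rewrite !ler_norml => /andP[? ?]; apply/andP; split; lra.
have -> : tau xs m.+1 - x * tau xs m - (1 - x) * T =
  (tau xs m.+1 - T) - x * (tau xs m - T) by ring.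
apply: le_trans (ler_normB _ _) _; rewrite normrM (ger0_norm x0).
apply: le_trans (lerD (IH m.+1) (ler_wpM2l x0 (IH m))) _.
have f0 : 0 < m.+2`!%:R :> R by rewrite ltr0n fact_gt0.
have g0 : 0 < m.+1`!%:R :> R by rewrite ltr0n fact_gt0.
rewrite [x + S]addrC; apply: le_trans (ler_wpM2r _ (exprD_ge2 m.+1 x0 S0)).
  rewrite mulrDl lerD2l [in leRHS]factS natrM le_eqVlt; apply/orP; left.
  by apply/eqP; field; rewrite !gt_eqF // ltr0n.
by rewrite invr_ge0 ltW.
Qed.

(** [F] has mean [M] on every residue class whose modulus is coprime to [s], with one error for all
    classes and lengths. The free modulus leaves room to impose a condition at a new prime, so the
    sieve sum is never expanded over divisors. *)
Definition equid s F M W := forall D r N, (0 < D)%N ->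
  {in s, forall p, coprime D p} ->
  `| \sum_(0 <= n < N | n == r %[mod D]) F n - M * N%:R / D%:R | <= W.

Lemma count_modn D r N : (0 < D)%N ->
  (\sum_(0 <= n < N | n == r %[mod D]) 1 = (N + (D.-1 - r %% D)) %/ D)%N.
Proof.
move=> D0; have rD := ltn_pmod r D0.
elim: N => [|N IHN]; first by rewrite big_geq // divn_small //; lia.
rewrite big_mkcond big_nat_recr //= -big_mkcond IHN addSn divnS // addnC.
congr (_ + _)%N; have -> : (N + (D.-1 - r %% D)).+1 = (N + D - r %% D)%N by lia.
have -> : (D %| N + D - r %% D)%N = (N == r %[mod D]).
  rewrite -eqn_mod_dvd; last by lia.
  by rewrite modnDr modn_mod eq_sym eq_sym.
by case: eqP.
Qed.

Lemma equid1 : equid [::] (fun=> 1) 1 1.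
Proof.
move=> D r N D0 _; have -> : \sum_(0 <= n < N | n == r %[mod D]) 1 =
  (\sum_(0 <= n < N | n == r %[mod D]) 1)%N%:R :> R by rewrite natr_sum.
rewrite count_modn //.
have rD := ltn_pmod r D0; have D0R : 0 < D%:R :> R by rewrite ltr0n.
set q := (_ %/ D)%N; rewrite mul1r ler_norml.
have h1 : (q * D <= N + D)%N by have := leq_trunc_div (N + (D.-1 - r %% D)) D; rewrite -/q; lia.
have h2 : (N <= q.+1 * D)%N by have := ltn_ceil (N + (D.-1 - r %% D)) D0; rewrite -/q; lia.
have {}h1 : q%:R <= N%:R / D%:R + 1 :> R.
  by rewrite -(ler_pM2r D0R) mulrDl divfK ?gt_eqF // mul1r -natrM -natrD ler_nat.
have {}h2 : N%:R / D%:R <= q%:R + 1 :> R.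
  by rewrite ler_pdivrMr // natr1 -natrM ler_nat.
by apply/andP; split; lra.
Qed.

Lemma equid_sub s s' F M W W' : {subset s <= s'} -> W <= W' ->
  equid s F M W -> equid s' F M W'.
Proof.
move=> ss' WW' eF D r N D0 cD; apply: le_trans WW'.
by apply: eF => // p /ss' /cD.
Qed.

Lemma equidD s F G M M' W W' : equid s F M W -> equid s G M' W' ->
  equid s (fun n => F n + G n) (M + M') (W + W').
Proof.
move=> eF eG D r N D0 cD; rewrite big_split /=.
have -> : forall a b c d : R, a + b - (M + M') * c / d = (a - M * c / d) + (b - M' * c / d).
  by move=> a b c d; ring.
exact: le_trans (ler_normD _ _) (lerD (eF D r N D0 cD) (eG D r N D0 cD)).
Qed.

Lemma equidN s F M W : equid s F M W -> equid s (fun n => - F n) (- M) W.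
Proof.
move=> eF D r N D0 cD; rewrite sumrN !mulNr -opprD normrN.
exact: eF.
Qed.

Lemma equid_ext s F G M M' W : F =1 G -> M = M' -> equid s F M W -> equid s G M' W.
Proof.
move=> FG <- eF D r N D0 cD; have := eF D r N D0 cD.
by rewrite (eq_bigr G).
Qed.

(** The Chinese remainder theorem merges the class modulo [D] and the class modulo [p] into one
    class modulo [D * p], still coprime to [s]; hence the error does not grow. *)
Lemma equid_residue s F M W p a : prime p -> all prime s -> p \notin s ->
  equid s F M W ->
  equid (p :: s) (fun n => F n * (n == a %[mod p])%:R) (M / p%:R) W.
Proof.
move=> pp ps pNs eF D r N D0 cD.
have cDp : coprime D p by apply: cD; rewrite mem_head.
have p0 := prime_gt0 pp.
have := eF (D * p)%N (chinese D p r a) N; rewrite muln_gt0 D0 p0 => /(_ isT).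
have cDps : {in s, forall q, coprime (D * p) q}.
  move=> q qs; have cDq : coprime D q by apply: cD; rewrite inE qs orbT.
  rewrite coprimeMl cDq prime_coprime // dvdn_prime2 ?(allP ps q qs) //.
  by apply: contraNneq pNs => ->.
move=> /(_ cDps); rewrite natrM invfM.
have -> : M * N%:R * (D%:R^-1 * p%:R^-1) = M / p%:R * N%:R / D%:R :> R by ring.
suff -> : \sum_(0 <= n < N | n == chinese D p r a %[mod D * p]) F n =
  \sum_(0 <= n < N | n == r %[mod D]) F n * (n == a %[mod p])%:R by [].
rewrite big_mkcond [RHS]big_mkcond; apply: eq_bigr => n _.
rewrite chinese_remainder // chinese_modl // chinese_modr //.
by case: eqP; case: eqP => //=; rewrite ?mulr1 ?mulr0.
Qed.

(* Besides 0, each prime of Q forbids the residue class of 1. *)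
Definition hit (Q : pred nat) n p : R :=
  (n == 0 %[mod p])%:R + (Q p && (n == 1 %[mod p]))%:R.

Definition omega (Q : pred nat) p : R := (1 + (Q p)%:R) / p%:R.

Lemma equid_hit Q s F M W p : prime p -> all prime s -> p \notin s -> 0 <= W ->
  equid s F M W ->
  equid (p :: s) (fun n => F n * hit Q n p) (M * omega Q p) (2 * W).
Proof.
move=> pp ps pNs W0 eF.
have e0 := equid_residue 0 pp ps pNs eF; have e1 := equid_residue 1 pp ps pNs eF.
case Qp : (Q p); last first.
  have WW : W <= 2 * W by lra.
  apply: (equid_sub (fun q qs => qs) WW); apply: equid_ext e0 => [n|]; first by rewrite /hit Qp addr0.
  by rewrite /omega Qp addr0 div1r.
have -> : 2 * W = W + W by lra.
apply: equid_ext (equidD e0 e1) => [n|].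
  by rewrite /hit Qp mulrDr.
by rewrite /omega Qp /= mulrDl mulrDr div1r.
Qed.

(** Unfolding [tau] at [p] subtracts a term of order one less in which [p] has joined the primes [t]
    and the error has doubled. With [k = 2 |s| + 1] for the remaining [s], the errors add up through
    [k ^ (m + 1) + 2 k ^ m <= (k + 2) ^ (m + 1)]. *)
Lemma equid_tau Q s t m F M W : uniq s -> all prime s -> all prime t ->
  ~~ has (mem t) s -> 0 <= W -> equid t F M W ->
  equid (s ++ t) (fun n => F n * tau (map (hit Q n) s) m)
    (M * tau (map (omega Q) s) m) (W * (size s).*2.+1%:R ^+ m).
Proof.
move=> us ps pt st W0 eF; move: us ps st m pt F M W0 eF; elim: s t W => [|p s IHs] /=.
  move=> t W _ _ _ m pt F M W0 eF; rewrite /= expr1n !mulr1.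
  by apply: equid_ext eF => // n; rewrite mulr1.
move=> t W /andP[pNs us] /andP[pp ps]; rewrite negb_or => /andP[pNt st] m pt F M W0 eF.
case: m => [|m].
  rewrite mulr1 expr0 mulr1.
  have sub : {subset t <= p :: s ++ t} by move=> q qt; rewrite inE mem_cat qt !orbT.
  by apply: (equid_sub sub (lexx W)); apply: equid_ext eF => // n; rewrite mulr1.
have st' : ~~ has (mem (p :: t)) s.
  apply/hasPn => q qs; rewrite inE negb_or; apply/andP; split.
    by apply: contraNneq pNs => <-.
  exact: (hasPn st).
have e1 := IHs _ _ us ps st m.+1 pt _ _ W0 eF.
have W20 : 0 <= 2 * W by lra.
have ppt : all prime (p :: t) by rewrite /= pp.
have e2 := IHs _ _ us ps st' m ppt _ _ W20 (equid_hit Q pp pt pNt W0 eF).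
have sub1 : {subset s ++ t <= p :: s ++ t} by move=> q qst; rewrite inE qst orbT.
have sub2 : {subset s ++ p :: t <= p :: s ++ t}.
  by move=> q; rewrite !(inE, mem_cat) orbCA.
have {}e1 := equid_sub sub1 (lexx _) e1; have {}e2 := equid_sub sub2 (lexx _) e2.
apply: equid_sub (fun q qs => qs) _ (equid_ext _ _ (equidD e1 (equidN e2))).
- rewrite !exprS doubleS; set k := (size s).*2.+1.
  rewrite -[k.+2%:R]natr1 -[k.+1%:R]natr1.
  have le1 : k%:R ^+ m <= k.+2%:R ^+ m :> R.
    by rewrite lerXn2r ?nnegrE // ler_nat; lia.
  rewrite -[k.+2%:R]natr1 -[k.+1%:R]natr1 in le1.
  have k0 : 0 <= k%:R :> R by [].
  move: le1; set u := _ ^+ m; set v := _ ^+ m; set z := k%:R in k0 *.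
  move=> uv; have : 0 <= W * ((z + 2) * (v - u)).
    by rewrite mulr_ge0 // mulr_ge0 //; lra.
  lra.
- by move=> n; ring.
- by ring.
Qed.

End Sieve.

(** * The Brun-Hooley upper bound *)

Section BrunHooley.
Variable R : realType.
Implicit Types (Q : pred nat) (n p t u j N : nat).

Definition primes_btw a b : seq nat := [seq p <- index_iota a.+1 b.+1 | prime p].

Definition block j := primes_btw (tower j) (tower j.+1).

(* Inclusion-exclusion over block j is truncated at this order. It decreases to 0
   as the blocks grow, which keeps the total error below tower (t + 3). *)
Definition level t j := (t - j.+1).*2.

Definition sifted Q t n := all
  (fun p => (n != 0 %[mod p]) && ~~ (Q p && (n == 1 %[mod p]))) (primes_btw 2 (tower t)).

Lemma mem_primes_btw a b p : (p \in primes_btw a b) = [&& prime p, (a < p)%N & (p <= b)%N].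
Proof. by rewrite mem_filter mem_index_iota ltnS. Qed.

Lemma equid_blocks Q t u : equid (primes_btw 2 (tower u))
  (fun n => \prod_(0 <= j < u) tau (map (hit R Q n) (block j)) (level t j))
  (\prod_(0 <= j < u) tau (map (omega R Q) (block j)) (level t j))
  (\prod_(0 <= j < u) (size (block j)).*2.+1%:R ^+ level t j).
Proof.
elim: u => [|u IHu].
  rewrite !big_geq //; apply: equid_ext (@equid1 R) => // n.
  by rewrite big_geq.
have all_p a b : all prime (primes_btw a b).
  by apply/allP => p; rewrite mem_primes_btw => /and3P[].
have disj : ~~ has (mem (primes_btw 2 (tower u))) (block u).
  apply/hasPn => p; rewrite inE !mem_primes_btw => /and3P[-> lt_p _] /=.
  by rewrite [X in _ && X]leqNgt lt_p andbF.
have un : uniq (block u) by rewrite filter_uniq ?iota_uniq.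
have W0 : 0 <= \prod_(0 <= j < u) (size (block j)).*2.+1%:R ^+ level t j :> R.
  by apply: prodr_ge0 => j _; rewrite exprn_ge0.
have sub : {subset block u ++ primes_btw 2 (tower u) <= primes_btw 2 (tower u.+1)}.
  have le2 := tower_ge2 u; have leS : (tower u <= tower u.+1)%N by rewrite leq_tower.
  move=> p; rewrite mem_cat !mem_primes_btw.
  case/orP=> /and3P[-> h1 h2] /=; apply/andP; split=> //.
    exact: leq_ltn_trans h1.
  exact: leq_trans leS.
have := equid_tau Q (level t u) un (all_p _ _) (all_p _ _) disj W0 IHu.
move/(equid_sub sub (lexx _)); rewrite !big_nat_recr //=.
by apply: equid_ext => // n; rewrite big_nat_recr.
Qed.

Lemma sum_exp2 t : (\sum_(0 <= j < t) 2 ^ j).+1 = (2 ^ t)%N.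
Proof.
elim: t => [|t IHt]; first by rewrite big_geq.
by rewrite big_nat_recr //= -addSn IHt expnS addnn mul2n.
Qed.

Lemma sum_exp2_level t : (\sum_(0 <= j < t) 2 ^ j * (t - j.+1) <= 2 ^ t)%N.
Proof.
suff : (\sum_(0 <= j < t) 2 ^ j * (t - j.+1) + t.+1 = 2 ^ t)%N by lia.
elim: t => [|t IHt]; first by rewrite big_geq.
rewrite big_nat_recr //= subnn muln0 addn0.
rewrite (eq_big_nat _ _ (F2 := fun j => 2 ^ j * (t - j.+1) + 2 ^ j)%N).
  by rewrite big_split /= expnS; have := sum_exp2 t; lia.
by move=> j /andP[_ jt]; rewrite subSS -[(t - j)%N]prednK ?subn_gt0 // mulnS addnC -subnS.
Qed.

(** Each base is at most [tower (j + 2)], so block [j] contributes the exponent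
    [8 * 2 ^ j * (t - j - 1)] of [2]; these sum to at most [8 * 2 ^ t]. *)
Lemma sieve_error_le t :
  \prod_(0 <= j < t) (size (block j)).*2.+1%:R ^+ level t j <= (tower (t + 3))%:R :> R.
Proof.
have -> : (tower (t + 3))%:R = (2 ^ (8 * 2 ^ t))%N%:R :> R.
  by rewrite /tower expnD mulnC.
have le_pow : (2 ^ (8 * \sum_(0 <= j < t) 2 ^ j * (t - j.+1)) <= 2 ^ (8 * 2 ^ t))%N.
  by rewrite leq_exp2l // leq_mul2l sum_exp2_level.
apply: le_trans (_ : (2 ^ (8 * \sum_(0 <= j < t) 2 ^ j * (t - j.+1)))%N%:R <= _); last first.
  by rewrite ler_nat.
rewrite big_distrr /= expn_sum natr_prod; apply: ler_prod => j _.
rewrite exprn_ge0 //= -natrX ler_nat.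
have -> : (8 * (2 ^ j * (t - j.+1)) = 2 ^ j.+2 * level t j)%N.
  by rewrite /level -mul2n !expnS; lia.
rewrite expnM; case: (level t j) => // e; rewrite leq_exp2r //.
rewrite -[(2 ^ 2 ^ j.+2)%N]/(tower j.+2) towerS.
have : (size (block j) <= tower j.+1 - tower j)%N.
  by rewrite size_filter (leq_trans (count_size _ _)) // size_iota subSS.
have := tower_ge2 j; have := tower_ge2 j.+1; rewrite -mul2n expnS expn1.
set a := tower j; set b := tower j.+1; set c := size _; nia.
Qed.

Lemma sum_blocks (f : nat -> R) t : \sum_(0 <= j < t) \sum_(p <- block j) f p =
  \sum_(p <- primes_btw 2 (tower t)) f p.
Proof.
elim: t => [|t IHt]; first by rewrite !big_geq // big_nil.
rewrite big_nat_recr //= IHt !big_filter [RHS](big_cat_nat (n := (tower t).+1)) //=.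
  by rewrite ltnS tower_ge2.
by rewrite ltnS leq_tower.
Qed.

(** The numbers [level t j + 1] are the odd numbers below [2 t], each once, so the sum is part of
    the exponential series. *)
Lemma sum_odd_exp_coeff (x : R) t : 0 <= x ->
  \sum_(0 <= j < t) x ^+ (level t j).+1 / (level t j).+1`!%:R <= expR x.
Proof.
move=> x0.
have le1 : \sum_(0 <= j < t) exp_coeff x (level t j).+1 <= series (exp_coeff x) t.*2.
  elim: t => [|t IHt]; first by rewrite big_geq // /series /= big_geq.
  rewrite big_nat_recl //= {1}/level subSS subn0 addrC.
  have -> : series (exp_coeff x) t.+1.*2 =
      series (exp_coeff x) t.*2 + exp_coeff x t.*2 + exp_coeff x t.*2.+1.
    by rewrite doubleS /series /= !big_nat_recr.
  rewrite lerD2r; apply: le_trans (_ : series (exp_coeff x) t.*2 <= _) => //.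
  by rewrite lerDl exp_coeff_ge0.
apply: le_trans (_ : series (exp_coeff x) t.*2 <= _).
  apply: le_trans le1; apply: ler_sum => j _.
  by rewrite exp_coeffE mulrC.
apply: nondecreasing_cvgn_le (is_cvg_series_exp_coeff x) _.
by apply/nondecreasing_seqP => n; rewrite /series /= big_nat_recr //= lerDl exp_coeff_ge0.
Qed.

Lemma omega_itv Q p : prime p -> (2 < p)%N -> 0 <= omega R Q p <= 1.
Proof.
move=> pp p2; have p2R : 2 <= p%:R :> R by rewrite ler_nat ltnW.
rewrite /omega divr_ge0 ?addr_ge0 //=.
by rewrite ler_pdivrMr; case: (Q p) => /=; lra.
Qed.

Lemma hit_itv Q n p : prime p -> 0 <= hit R Q n p <= 1.
Proof.
move=> pp; rewrite /hit addr_ge0 //=.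
have [n0|] := eqVneq (n %% p)%N (0 %% p)%N; last by rewrite add0r; case: (_ && _).
have -> : (n %% p == 1 %% p)%N = false.
  by rewrite n0 mod0n modn_small ?prime_gt1.
by rewrite andbF addr0.
Qed.

(** The additive truncation error is made multiplicative through [1 <= expR (- S) * expR L], so that
    over all blocks the errors simply add up in the exponent. *)
Lemma tau_block_le Q t j (L : R) : \sum_(p <- block j) omega R Q p <= L ->
  0 <= tau (map (omega R Q) (block j)) (level t j) <=
  expR (- (\sum_(p <- block j) omega R Q p)
    + expR L * (L ^+ (level t j).+1 / (level t j).+1`!%:R)).
Proof.
set S := \sum_(_ <- _) _ => SL; set m := level t j.
have w01 p : p \in block j -> 0 <= omega R Q p <= 1.
  rewrite mem_primes_btw => /and3P[pp jp _].
  by apply: omega_itv => //; apply: leq_ltn_trans jp; apply: tower_ge2.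
have h01 : all (fun x => 0 <= x <= 1) (map (omega R Q) (block j)).
  by apply/allP => _ /mapP[p /w01 + ->].
have S0 : 0 <= S.
  by rewrite /S big_seq sumr_ge0 // => p /w01/andP[].
have := bonferroni m h01; rewrite odd_double /= => ge_prod.
have /andP[prod0 _] := prod_1B_itv h01.
rewrite (le_trans prod0 ge_prod) /=.
have ES : \sum_(x <- map (omega R Q) (block j)) x = S by rewrite big_map.
have := tau_approx m h01; rewrite ES => /(le_trans (ler_norm _)).
rewrite lerBlDl => /le_trans; apply.
have prodS : \prod_(x <- map (omega R Q) (block j)) (1 - x) <= expR (- S).
  rewrite big_map /S -sumrN expR_sum big_seq [leRHS]big_seq.
  apply: ler_prod => p /w01/andP[_ w1].
  by have := expR_ge1Dx (- omega R Q p); move=> ge1; apply/andP; split; lra.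
have f0 : 0 < m.+1`!%:R :> R by rewrite ltr0n fact_gt0.
have cL : S ^+ m.+1 / m.+1`!%:R <= L ^+ m.+1 / m.+1`!%:R.
  by rewrite ler_pM2r ?invr_gt0 // lerXn2r // nnegrE (le_trans S0).
apply: le_trans (lerD prodS cL) _.
have c0 : 0 <= L ^+ m.+1 / m.+1`!%:R.
  by rewrite divr_ge0 // exprn_ge0 // (le_trans S0 SL).
move: c0; set c := L ^+ _ / _ => c0.
rewrite expRD; have := expR_ge1Dx (expR L * c).
have : 1 <= expR (- S) * expR L by rewrite -expRD -expR0 ler_expR; lra.
have := expR_gt0 (- S).
set a := expR (- S); set b := expR L; set d := expR (b * c) => a0 ab bd.
have : 0 <= a * (d - (1 + b * c)) by rewrite mulr_ge0 //; lra.
have : 0 <= (a * b - 1) * c by rewrite mulr_ge0 //; lra.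
lra.
Qed.

Lemma sum_omega Q t : \sum_(p <- primes_btw 2 (tower t)) omega R Q p =
  recip_primes R (tower t) - 2^-1
  + \sum_(3 <= p < (tower t).+1 | prime p && Q p) p%:R^-1.
Proof.
have -> : recip_primes R (tower t) - 2^-1 =
    \sum_(3 <= p < (tower t).+1 | prime p) p%:R^-1.
  by rewrite /recip_primes sum_primes_from3 ?tower_ge2 // -big_mkcond addrAC subrr add0r.
rewrite big_filter big_mkcondr /= -big_split /=; apply: eq_bigr => p _.
by rewrite /omega mulrDl div1r; case: (Q p); rewrite ?mul0r ?mul1r.
Qed.

(** Two classes per prime, and Mertens with error [6] at both ends: [2 * (ln 2 + 12) <= 28]. *)
Lemma sum_omega_block_le Q j : \sum_(p <- block j) omega R Q p <= 28.
Proof.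
have le_om p : omega R Q p <= 2 * p%:R^-1.
  by rewrite /omega ler_wpM2r ?invr_ge0 //; case: (Q p) => /=; lra.
apply: le_trans (ler_sum _ (fun p _ => le_om p)) _.
rewrite -mulr_sumr big_filter.
have : recip_primes R (tower j.+1) = recip_primes R (tower j)
    + \sum_((tower j).+1 <= p < (tower j.+1).+1 | prime p) p%:R^-1.
  by apply: big_cat_nat; rewrite // ltnS leq_tower.
have /andP[+ _] := recip_primes_tower R j.
have /andP[_ +] := recip_primes_tower R j.+1.
have : ln 2 < 2 :> R by apply: ln_sublinear.
rewrite -[j.+1%:R]natr1.
set s := \sum_(_ <= _ < _ | _) _; lra.
Qed.

Lemma sieve_le : exists2 C : R, 0 < C & forall Q t N, (tower (t + 4) <= N)%N ->
  \sum_(0 <= n < N | sifted Q t n) 1 <=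
  C * (N%:R * 2^-1 ^+ t
    * expR (- \sum_(3 <= p < (tower t).+1 | prime p && Q p) p%:R^-1)).
Proof.
have [L EL] : exists L : R, L = 28 by eexists.
exists (expR (7 + expR L * expR L) + expR 6) => [|Q t N tN].
  by rewrite addr_gt0 ?expR_gt0.
set SQ := \sum_(3 <= p < _ | _) _.
have L0 : 0 <= L by rewrite EL.
have l2 := ln2_ge R.
have half : 2^-1 ^+ t = expR (- (t%:R * ln 2)) :> R.
  by rewrite expRN expRM_natl lnK ?posrE // exprVn.
have /andP[recip_lo recip_up] := recip_primes_tower R t.
have hits n p : p \in primes_btw 2 (tower t) -> 0 <= hit R Q n p <= 1.
  by rewrite mem_primes_btw => /and3P[pp _ _]; apply: hit_itv.
have sub j p : (j < t)%N -> p \in block j -> p \in primes_btw 2 (tower t).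
  rewrite !mem_primes_btw => jt /and3P[-> h1 h2] /=.
  rewrite (leq_ltn_trans (tower_ge2 j) h1) (leq_trans h2) // leq_tower //.
(* All levels are even, so each block factor majorises the indicator of its block and is
   nonnegative; therefore the product majorises the indicator of [sifted]. *)
have step1 : \sum_(0 <= n < N | sifted Q t n) 1 <=
    \sum_(0 <= n < N | n == 0 %[mod 1])
      \prod_(0 <= j < t) tau (map (hit R Q n) (block j)) (level t j).
  rewrite [leLHS]big_mkcond [leRHS]big_mkcond /=.
  apply: ler_sum => n _; rewrite !modn1 eqxx.
  have ge_prod j : (j < t)%N -> \prod_(p <- block j) (1 - hit R Q n p)
      <= tau (map (hit R Q n) (block j)) (level t j) /\
      0 <= \prod_(p <- block j) (1 - hit R Q n p).
    move=> jt; have h : all (fun x => 0 <= x <= 1) (map (hit R Q n) (block j)).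
      by apply/allP => _ /mapP[p pj ->]; apply/hits/(sub j).
    have := bonferroni (level t j) h; rewrite odd_double big_map => ->.
    by have /andP[+ _] := prod_1B_itv h; rewrite big_map.
  rewrite big_nat; case: ifP => [sift|_]; last first.
    by apply: prodr_ge0 => j jt; have [h1 h2] := ge_prod j jt; exact: le_trans h1.
  apply: le_trans (_ : \prod_(0 <= j < t | (0 <= j < t)%N) 1 <= _).
    by rewrite big1.
  apply: ler_prod => j jt; rewrite ler01 /=.
  have [h1 _] := ge_prod j jt; apply: le_trans h1.
  rewrite big_seq big1 // => p pj.
  have /andP[h0 h1] := allP sift _ (sub j p jt pj).
  by rewrite /hit (negPf h0) (negPf h1) addr0 subr0.
have cop : {in primes_btw 2 (tower t), forall p, coprime 1 p}.
  by move=> p _; rewrite coprime1n.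
have := @equid_blocks Q t t 1%N 0%N N isT cop.
rewrite divr1 => /(le_trans (ler_norm _)); rewrite lerBlDr.
move=> /(le_trans step1) {}step1; apply: le_trans step1 _.
(* The [7] covers the Mertens error [6] and the [1 / 2] of the prime [2]; the truncation errors of
   all blocks together cost [expR L * expR L]. *)
have main : \prod_(0 <= j < t) tau (map (omega R Q) (block j)) (level t j)
    <= expR (- (t%:R * ln 2)) * (expR (7 + expR L * expR L) * expR (- SQ)).
  have SL j : \sum_(p <- block j) omega R Q p <= L by rewrite EL sum_omega_block_le.
  apply: le_trans (ler_prod _ (fun j _ => tau_block_le t (SL j))) _.
  rewrite -expR_sum big_split /= sumrN sum_blocks sum_omega -/SQ -mulr_sumr.
  rewrite -(expRD (7 + _)) -expRD ler_expR.
  have := ler_wpM2l (expR_ge0 L) (sum_odd_exp_coeff t L0).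
  set a := _ * \sum_(_ <= _ < _) _; lra.
have {main}main := ler_wpM2r (ler0n R N) main.
(* The main term loses at most [4 ^ t] up to a constant, which is below [tower (t + 3)], and [N] is
   at least the square of [tower (t + 3)]. *)
have err : (tower (t + 3))%:R <= expR 6 * (N%:R * 2^-1 ^+ t * expR (- SQ)).
  have SQle : SQ <= t%:R * ln 2 + 6.
    apply: le_trans recip_up; rewrite /recip_primes.
    rewrite sum_primes_from3 ?tower_ge2 // ler_wpDl ?invr_ge0 // /SQ big_mkcond /=.
    by apply: ler_sum => p _; case: (prime p); case: (Q p) => //=; rewrite ?invr_ge0.
  have le1 : 2^-1 ^+ t <= expR 6 * expR (- SQ) by rewrite half -expRD ler_expR; lra.
  have le2 : (tower (t + 3))%:R <= N%:R * (2^-1 ^+ t * 2^-1 ^+ t) :> R.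
    rewrite -exprMn -invfM exprVn ler_pdivlMr ?exprn_gt0 // -natrM -natrX -natrM ler_nat.
    apply: leq_trans tN; rewrite [(t + 4)%N]addnS towerS -mulnn leq_mul2l; apply/orP; right.
    rewrite mulnn -expnM leq_exp2l // expnD.
    by have := ltn_expl t (isT : (1 < 2)%N); lia.
  apply: le_trans le2 _.
  rewrite [leRHS](_ : _ = N%:R * 2^-1 ^+ t * (expR 6 * expR (- SQ))); last by ring.
  by rewrite mulrA ler_wpM2l // mulr_ge0 // exprn_ge0 // invr_ge0.
apply: le_trans (lerD (le_trans (sieve_error_le t) err) main) _.
by rewrite half; lra.
Qed.

End BrunHooley.

(** * From chain lengths to sifted integers *)

Lemma H_prec p q : prime p -> prime q -> prec p q -> (H p < H q)%N.
Proof.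
move=> pp pq lt_pq; apply: H_max.
have [s [/and3P[s0 ps chs] lst <-]] := H_attained pp.
exists (rcons s q); split; last by rewrite size_rcons.
- case: s s0 ps chs lst => // a s _ /= /andP[pa ps] chs lst.
  by rewrite /prime_chain /= rcons_path chs lst lt_pq all_rcons pa pq ps.
- by rewrite last_rcons.
Qed.

Lemma tower_bracket n0 N : (tower n0 < N)%N ->
  exists n, [/\ (n0 <= n)%N, (tower n < N)%N & (N <= tower n.+1)%N].
Proof.
move=> n0N; have exN : exists m, (N <= tower m)%N.
  exists N; apply: leq_trans (ltnW (ltn_expl N (isT : (1 < 2)%N))) _.
  by rewrite leq_exp2l // ltnW // ltn_expl.
have [m Nm minm] := ex_minnP exN.
have n0m : (n0 < m)%N by rewrite ltnNge -leq_tower -ltnNge (leq_trans n0N).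
case: m Nm minm n0m => // n Nm minm n0n; exists n; split=> //.
by rewrite ltnNge; apply/negP => /minm; rewrite ltnn.
Qed.

Section Exceptions.
Variable R : realType.
Implicit Types (K c G : R) (f g h : R -> R) (P Q : pred nat) (n i N : nat).

Definition slow K f := {in `[1, +oo[ &, {homo f : x y / x <= y}} /\
  (forall x : R, 1 <= x -> f (x ^+ 2) - f x <= K).

Definition exceptional g h : pred nat := fun p => ~~ (h p%:R - g p%:R <= (H p)%:R).

Lemma slow_le K f x y : slow K f -> 1 <= x -> x <= y -> f x <= f y.
Proof.
case=> mf _ x1 xy; apply: mf => //; rewrite in_itv /= andbT //.
exact: le_trans xy.
Qed.

Lemma tower_ge1 n : 1 <= (tower n)%:R :> R.
Proof. by rewrite ler1n tower_gt0. Qed.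

Lemma slow_tower K f n k : slow K f ->
  f (tower (n + k))%:R <= f (tower n)%:R + k%:R * K.
Proof.
case=> _ sf; elim: k => [|k IHk]; first by rewrite addn0 mul0r addr0.
have := sf _ (tower_ge1 (n + k)).
rewrite addnS towerS natrX -[k.+1%:R]natr1; lra.
Qed.

Lemma cnt_sub P Q N : (forall p, prime p -> P p -> Q p) -> cnt R P N <= cnt R Q N.
Proof.
move=> PQ; rewrite /cnt big_mkcond [leRHS]big_mkcond; apply: ler_sum => p _ /=.
by case: (boolP (prime p)) => //= pp; have := PQ p pp; case: (P p); case: (Q p) => // /(_ isT).
Qed.

Lemma cntC Q N : cnt R Q N + cnt R (fun p => ~~ Q p) N = cnt R predT N.
Proof.
rewrite /cnt big_mkcond [X in _ + X]big_mkcond [RHS]big_mkcond -big_split /=.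
apply: eq_bigr => p _; case: (prime p) => /=; last by rewrite addr0.
by case: (Q p); rewrite /= ?addr0 ?add0r.
Qed.

Lemma count_primesE (x : R) P : (count_primes x P)%:R = cnt R P (Num.truncn x).
Proof.
rewrite /count_primes -sum1dep_card natr_sum /cnt.
by rewrite (big_mkord (fun p => prime p && P p) (fun=> 1)).
Qed.

(** The [13] is twice the Mertens error [6], plus the [1] lost in [density_sum_recip]; for [t < i]
    the left side is negative. *)
Lemma sieve_sum_ge Q c t i : 0 <= c <= 1 ->
  (forall n, (tower i <= n)%N -> c * cnt R predT n <= cnt R Q n) ->
  c * ln 2 * (t%:R - i%:R) - 13 <=
  \sum_(3 <= p < (tower t).+1 | prime p && (Q p && (tower i < p)%N)) p%:R^-1.
Proof.
move=> /andP[c0 c1] dQ; have l2 := ln2_ge R.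
have sum0 a b P : 0 <= \sum_(a <= p < b | P p) p%:R^-1 :> R.
  by apply: sumr_ge0 => p _; rewrite invr_ge0.
have [ti|it] := ltnP t i.
  have ltR : t%:R <= i%:R :> R by rewrite ler_nat ltnW.
  apply: le_trans (sum0 _ _ _).
  have : 0 <= c * ln 2 * (i%:R - t%:R) by rewrite !mulr_ge0 //; lra.
  lra.
have le_it : (tower i <= tower t)%N by rewrite leq_tower.
have := density_sum_recip le_it c0 dQ.
have /andP[e1 e2] := recip_primes_tower R i; have /andP[e3 e4] := recip_primes_tower R t.
rewrite (big_cat_nat (m := 3) (n := (tower i).+1)) //=; last exact: tower_ge2.
have -> : \sum_((tower i).+1 <= p < (tower t).+1 | prime p && (Q p && (tower i < p)%N)) p%:R^-1
   = \sum_((tower i).+1 <= p < (tower t).+1 | prime p && Q p) p%:R^-1 :> R.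
  rewrite big_nat_cond [RHS]big_nat_cond; apply: eq_bigl => p.
  by case: (boolP (tower i < p)%N) => //=; rewrite andbT.
have := sum0 3%N (tower i).+1 (fun p => prime p && (Q p && (tower i < p)%N)).
set a := \sum_(_ <= _ < _ | _) _; set b := \sum_(_ <= _ < _ | _) _.
set x := recip_primes R _ in e3 e4 *; set y := recip_primes R _ in e1 e2 *.
have : 0 <= c * (x - y - (t%:R - i%:R) * ln 2 + 12) by rewrite mulr_ge0 //; lra.
lra.
Qed.

(** A good [q] above [tower i] dividing [p - 1] gives [H p >= h q - G], and [h] loses at most
    [(n + 1 - i) * K] between [p] and [q]. The deficit [G] is [0] in the bounded case and positive
    once the density has been raised. The offset [4] is the one that [sieve_le] demands. *)
Lemma exceptional_sifted K g h Q G n i p : slow K g -> slow K h ->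
  (forall q, prime q -> Q q -> h q%:R - G <= (H q)%:R) ->
  (i <= n.+1)%N -> (n.+1 - i)%:R * K <= g (tower n.-1)%:R - G ->
  prime p -> (tower n.-1 < p)%N -> (p <= tower n.+1)%N -> exceptional g h p ->
  sifted (fun q => Q q && (tower i < q)%N) (n - 4) p.
Proof.
move=> sg sh hQ ile Kle pp ltp lep; apply: contraNT.
case/allPn => q; rewrite mem_primes_btw => /and3P[pq q2 qt].
have qp : (q < p)%N.
  by apply: leq_ltn_trans ltp; apply: leq_trans qt _; rewrite leq_tower; lia.
rewrite negb_and negbK => /orP[|].
  by rewrite mod0n -/(dvdn q p) dvdn_prime2 // => /eqP qE; rewrite qE ltnn in qp.
rewrite negbK => /andP[/andP[Qq iq] pq1].
have Hlt : (H q)%:R <= (H p)%:R :> R by rewrite ler_nat ltnW // H_prec.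
have := hQ q pq Qq.
have : h p%:R <= h (tower n.+1)%:R.
  by apply: (slow_le sh); rewrite ?ler1n ?prime_gt0 // ler_nat.
have : h (tower i)%:R <= h q%:R.
  by apply: (slow_le sh); rewrite ?tower_ge1 // ler_nat ltnW.
have : g (tower n.-1)%:R <= g p%:R.
  by apply: (slow_le sg); rewrite ?tower_ge1 // ler_nat ltnW.
have := slow_tower i (n.+1 - i) sh; rewrite subnKC //.
lra.
Qed.

Lemma exceptional_le : exists2 C : R, 0 < C & forall K c g h Q G n i N,
  0 <= c <= 1 -> slow K g -> slow K h ->
  (forall m, (tower i <= m)%N -> c * cnt R predT m <= cnt R Q m) ->
  (forall q, prime q -> Q q -> h q%:R - G <= (H q)%:R) ->
  (4 <= n)%N -> (i <= n.+1)%N -> (n.+1 - i)%:R * K <= g (tower n.-1)%:R - G ->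
  (tower n < N)%N -> (N <= tower n.+1)%N ->
  cnt R (exceptional g h) N <=
  (tower n.-1)%:R + C * (cnt R predT N * expR (- (c * ln 2 * (n%:R - 4 - i%:R)))).
Proof.
have [C C0 sieve] := sieve_le R.
exists (C * expR 13 * (2 ^+ 18)); first by rewrite !mulr_gt0 ?expR_gt0 ?exprn_gt0.
move=> K c g h Q G n i N c01 sg sh dQ hQ n4 ile Kle nN Nn.
have l2 := ln2_ge R.
set Q' : pred nat := fun q => Q q && (tower i < q)%N.
have le1 : cnt R (exceptional g h) N <=
    (tower n.-1)%:R + \sum_(0 <= p < N.+1 | sifted Q' (n - 4) p) 1.
  apply: le_trans (_ : cnt R (fun p => p <= tower n.-1)%N N +
    \sum_(0 <= p < N.+1 | sifted Q' (n - 4) p) 1 <= _).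
    rewrite /cnt big_mkcond [X in _ <= X + _]big_mkcond [X in _ <= _ + X]big_mkcond.
    rewrite -big_split /=; apply: ler_sum_nat => p /andP[_]; rewrite ltnS => pN.
    case: ifP => [/andP[pp ep]|_]; last by rewrite addr_ge0 //; case: ifP.
    rewrite pp /=; case: (leqP p (tower n.-1)) => [_|ltp].
      by rewrite lerDl; case: ifP.
    by rewrite (exceptional_sifted sg sh hQ ile Kle pp ltp (leq_trans pN Nn) ep) add0r.
  rewrite lerD2r; have nN' : (tower n.-1 <= N)%N.
    by apply: leq_trans (ltnW nN); rewrite leq_tower leq_pred.
  apply: le_trans (cnt_le R predT (tower n.-1)).
  rewrite /cnt (big_cat_nat (n := (tower n.-1).+1)) //=.
  rewrite [X in _ + X]big1_seq ?addr0; last first.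
    move=> p; rewrite mem_index_iota => /andP[/andP[_ h1] /andP[h2 _]].
    by rewrite leqNgt h2 in h1.
  by rewrite big_mkcond [leRHS]big_mkcond; apply: ler_sum => p _; case: (prime p); case: (p <= _)%N.
apply: le_trans le1 _; rewrite lerD2l.
have tN : (tower (n - 4 + 4) <= N.+1)%N by rewrite subnK // ltnW // ltnW.
apply: le_trans (sieve Q' _ _ tN) _.
have := sieve_sum_ge (n - 4) c01 dQ; rewrite -/Q' natrB //.
set S := \sum_(3 <= p < _ | _) _ => Sge.
(* The [2 ^ 18] below collects [2] from [N + 1 <= 2 N], [2 ^ 11] from Chebyshev, [2] from
   [ln 2 <= 2], and [2 ^ 5] from sifting only up to [tower (n - 4)]. *)
have N2 : (2 <= N)%N by apply: leq_trans (ltnW nN); apply: tower_ge2.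
have cnt0 : 0 <= cnt R predT N by rewrite (le_trans ler01) ?cnt_ge1.
have expS : expR (- S) <= expR 13 * expR (- (c * ln 2 * (n%:R - 4 - i%:R))).
  by rewrite -expRD ler_expR; lra.
have sizeN : N.+1%:R * 2^-1 ^+ (n - 4) <= 2 ^+ 18 * cnt R predT N :> R.
  rewrite exprVn ler_pdivrMr ?exprn_gt0 //.
  have lnN : ln N%:R <= 2 ^+ n.+1 * 2 :> R.
    apply: le_trans (_ : ln (tower n.+1)%:R <= _).
      by rewrite ler_ln_nat // ltnW.
    rewrite ln_tower ler_wpM2l ?exprn_ge0 //.
    by apply: ltW; apply: ln_sublinear.
  have : N.+1%:R <= 2 * N%:R :> R by rewrite -natrM ler_nat; lia.
  have := prime_count_ge R N2; have := ler_wpM2r cnt0 lnN.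
  have -> : 2 ^+ n.+1 = 2 ^+ 5 * 2 ^+ (n - 4) :> R by rewrite -exprD; congr (_ ^+ _); lia.
  rewrite (_ : 2 ^+ 18 = 2 ^+ 11 * 2 * (2 ^+ 5 * 2) :> R); last first.
    by rewrite -[18%N]/(11 + 1 + (5 + 1))%N !exprD !expr1.
  set u := 2 ^+ 11; set v := 2 ^+ 5; set w := 2 ^+ (n - 4); set L := ln _ => e1 e2 e3.
  have u0 : 0 <= u by rewrite exprn_ge0.
  have := ler_wpM2l u0 e1; lra.
have e0 := expR_ge0 (- S).
have [a Ea] : exists a : R, a = 2 ^+ 18 by eexists.
have a0 : 0 <= a by rewrite Ea exprn_ge0.
move: sizeN expS; rewrite -Ea; set X := expR (- (c * ln 2 * _)) => sizeN expS.
have -> : C * expR 13 * a * (cnt R predT N * X) =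
  C * (a * cnt R predT N * (expR 13 * X)) by ring.
rewrite ler_pM2l //; apply: le_trans (ler_wpM2r e0 sizeN) _.
by rewrite ler_wpM2l // mulr_ge0.
Qed.

End Exceptions.

(** * Bounded and unbounded [g] with an absolute constant *)

Section Conclusion.
Variable R : realType.
Implicit Types (K c G : R) (f g h : R -> R) (P Q : pred nat) (n i N : nat).

Lemma leq_3n_exp2 n : (5 <= n)%N -> (3 * n <= 2 ^ n.-1)%N.
Proof.
elim: n => // n IHn; rewrite leq_eqVlt => /orP[/eqP[<-] //|].
rewrite ltnS => n5; have := IHn n5; case: n n5 {IHn} => // n n4 /=.
by rewrite expnS; lia.
Qed.

Lemma slow_tower0 K g n : slow K g -> g (tower n)%:R <= g (tower 0)%:R + n%:R * K.
Proof. exact: (slow_tower 0 n). Qed.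

(** The primes up to [tower n.-1], which the sieve ignores, are negligible: [g] grows at most
    linearly in [n], so the claimed saving is at most [2 ^ (D + n)], whereas [N] exceeds the square
    of [tower n.-1]. *)
Lemma tower_le_cnt K c g : 0 < K -> 0 <= c <= 1 -> slow K g ->
  (forall x, 1 <= x -> 0 <= g x) ->
  exists n0, forall n N, (n0 <= n)%N -> (tower n < N)%N -> (N <= tower n.+1)%N ->
  (tower n.-1)%:R <= cnt R predT N * expR (- (c * ln 2 / K * g (tower n.-1)%:R)).
Proof.
move=> K0 /andP[c0 c1] sg g0; have l2 := ln2_ge R.
have [D ED] : exists D, D = (Num.truncn (g (tower 0)%:R / K)).+1 by eexists.
(* The final comparison is [2 n + D + 13 <= 3 n <= 2 ^ (n - 1)]. *)
exists (14 + D)%N => n N nD nN Nn.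
have gD : g (tower 0)%:R <= D%:R * K by rewrite ED -ler_pdivrMr // ltW // truncnS_gt.
have N2 : (2 <= N)%N by apply: leq_trans (ltnW nN); apply: tower_ge2.
have cnt0 : 0 <= cnt R predT N by rewrite (le_trans ler01) ?cnt_ge1.
have Tle : g (tower n.-1)%:R <= (D + n)%:R * K.
  apply: le_trans (slow_tower0 n.-1 sg) _.
  rewrite natrD mulrDl lerD // ler_wpM2r ?ler_nat ?leq_pred //; exact: ltW.
have expT : 2^-1 ^+ (D + n) <= expR (- (c * ln 2 / K * g (tower n.-1)%:R)).
  have -> : 2^-1 ^+ (D + n) = expR (- ((D + n)%:R * ln 2)) :> R.
    by rewrite expRN expRM_natl lnK ?posrE // exprVn.
  rewrite ler_expR lerN2.
  have -> : c * ln 2 / K * g (tower n.-1)%:R = c * (g (tower n.-1)%:R / K * ln 2).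
    by field; rewrite gt_eqF.
  have T0 := g0 _ (tower_ge1 R n.-1).
  have y0 : 0 <= g (tower n.-1)%:R / K * ln 2.
    by rewrite mulr_ge0 ?divr_ge0 ?(ltW K0) //; lra.
  apply: le_trans (ler_piMl y0 c1) _; rewrite ler_wpM2r //; first lra.
  by rewrite ler_pdivrMr.
apply: le_trans (ler_wpM2l cnt0 expT).
rewrite exprVn ler_pdivlMr ?exprn_gt0 //.
have lnN : ln N%:R <= 2 ^+ n.+1 * 2 :> R.
  apply: le_trans (_ : ln (tower n.+1)%:R <= _).
    by rewrite ler_ln_nat // ltnW.
  by rewrite ln_tower ler_wpM2l ?exprn_ge0 // ltW // ln_sublinear.
have := prime_count_ge R N2; have := ler_wpM2r cnt0 lnN.
have u0 : 0 < 2 ^+ 11 :> R by rewrite exprn_gt0.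
move=> e1 e2; have := le_trans e2 (ler_wpM2l (ltW u0) e1).
have -> : 2 ^+ 11 * (2 ^+ n.+1 * 2 * cnt R predT N) = 2 ^+ (n + 13) * cnt R predT N.
  rewrite mulrA; congr (_ * _); rewrite -exprSr -exprD; congr (_ ^+ _); clear; lia.
move=> {e1 e2}; set z := cnt R predT N => Nz.
rewrite -(ler_pM2l (_ : 0 < 2 ^+ (n + 13))) ?exprn_gt0 //.
apply: le_trans Nz; rewrite mulrCA -exprD -natrX -natrM ler_nat.
apply: leq_trans (ltnW nN).
have -> : tower n = (tower n.-1 * tower n.-1)%N.
  by rewrite mulnn -towerS prednK //; clear - nD; lia.
rewrite leq_mul2l; apply/orP; right.
rewrite leq_exp2l //; have := @leq_3n_exp2 n; clear - nD; lia.
Qed.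

(** Here [c] is the constant wanted in the exponent and [c1] the density at hand; they differ only
    in the unbounded case. The slack [12] allows six scales to be lost, as [c * ln 2 <= 2] for
    [c <= 1]. *)
Lemma exceptional_le_exp : exists2 C : R, 0 < C & forall K c c1 g h Q G n i N,
  0 <= c1 <= 1 -> slow K g -> slow K h ->
  (forall m, (tower i <= m)%N -> c1 * cnt R predT m <= cnt R Q m) ->
  (forall q, prime q -> Q q -> h q%:R - G <= (H q)%:R) ->
  (4 <= n)%N -> (i <= n.+1)%N -> (n.+1 - i)%:R * K <= g (tower n.-1)%:R - G ->
  (tower n < N)%N -> (N <= tower n.+1)%N ->
  c * ln 2 / K * g (tower n.-1)%:R - 12 <= c1 * ln 2 * (n%:R - 4 - i%:R) ->
  (tower n.-1)%:R <= cnt R predT N * expR (- (c * ln 2 / K * g (tower n.-1)%:R)) ->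
  cnt R (exceptional g h) N <=
  C * (cnt R predT N * expR (- (c * ln 2 / K * g (tower n.-1)%:R))).
Proof.
have [C C0 HC] := exceptional_le R; exists (1 + C * expR 12).
  by rewrite addr_gt0 // mulr_gt0 ?expR_gt0.
move=> K c c1 g h Q G n i N c01 sg sh dQ hQ n4 ile Kle nN Nn Xle small.
apply: le_trans (HC _ _ _ _ _ _ _ _ _ c01 sg sh dQ hQ n4 ile Kle nN Nn) _.
rewrite mulrDl mul1r; apply: lerD => //.
rewrite -[leRHS]mulrA ler_pM2l // mulrCA.
rewrite ler_wpM2l ?sumr_ge0 // -expRD ler_expR; lra.
Qed.

Lemma few_exceptions_bounded : exists2 C : R, 0 < C & forall K c g h N0 (B : R),
  0 < K -> 0 <= c <= 1 -> slow K g -> slow K h ->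
  (forall x, 1 <= x -> 0 <= g x) -> (forall x, 1 <= x -> g x <= B) ->
  (forall N, (N0 <= N)%N ->
    c * cnt R predT N <= cnt R (fun p => h p%:R <= (H p)%:R) N) ->
  exists n0, forall n N, (n0 <= n)%N -> (tower n < N)%N -> (N <= tower n.+1)%N ->
  cnt R (exceptional g h) N <=
  C * (cnt R predT N * expR (- (c * ln 2 / K * g (tower n.-1)%:R))).
Proof.
have [C C0 HC] := exceptional_le_exp; exists C => //.
move=> K c g h N0 B K0 c01 sg sh g0 gB dQ; have l2 := ln2_ge R.
have [n1 small] := tower_le_cnt K0 c01 sg g0.
have [J0 EJ0] : exists J0, J0 = Num.truncn (B / K) by eexists.
exists (maxn n1 (4 + J0 + N0)) => n N; rewrite geq_max => /andP[nn1 nJ] nN Nn.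
have T0 := g0 _ (tower_ge1 R n.-1); have TB := gB _ (tower_ge1 R n.-1).
have {small} := small n N nn1 nN Nn.
set T := g (tower n.-1)%:R in T0 TB * => small.
have [J EJ] : exists J, J = Num.truncn (T / K) by eexists.
have TK0 : 0 <= T / K by rewrite divr_ge0 // ltW.
have JJ0 : (J <= J0)%N by rewrite EJ EJ0; apply: le_truncn; rewrite ler_pM2r ?invr_gt0.
have JT : J%:R * K <= T by rewrite EJ -ler_pdivlMr // truncn_le.
have TJ : T / K <= J%:R + 1 by rewrite EJ natr1 ltW // truncnS_gt.
(* Since [J] stays below [J0], [i = n + 1 - J] passes [N0] for large [n], so the density is
   available from [tower i] on. *)
apply: (HC K c c g h (fun p => h p%:R <= (H p)%:R) 0 n (n.+1 - J)%N) => //.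
- move=> m mi; apply: dQ; apply: leq_trans mi.
  have N0i : (N0 <= n.+1 - J)%N by clear - nJ JJ0; lia.
  apply: leq_trans N0i _.
  apply: leq_trans (ltnW (ltn_expl _ (isT : (1 < 2)%N))) _.
  by rewrite leq_exp2l // ltnW // ltn_expl.
- by move=> q _; rewrite subr0.
- by clear - nJ; lia.
- by clear; lia.
- by rewrite subr0 subKn //; clear - nJ JJ0; lia.
rewrite -/T natrB; last by clear - nJ JJ0; lia.
have -> : c * ln 2 / K * T = c * ln 2 * (T / K) by field; rewrite gt_eqF.
have l2' : ln 2 < 2 :> R by apply: ln_sublinear.
case/andP: c01 => c0 c1; rewrite -[n.+1%:R]natr1.
have : 0 <= c * ln 2 * (J%:R + 1 - T / K) by rewrite !mulr_ge0 //; lra.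
have : c * ln 2 <= 2.
  by apply: le_trans (ler_piMl _ c1) _; lra.
lra.
Qed.

Lemma unbounded_tower K g (B : R) : slow K g ->
  (exists2 x, 1 <= x & B < g x) -> exists n0, forall n, (n0 <= n)%N -> B <= g (tower n)%:R.
Proof.
move=> sg [x x1 Bx]; exists (Num.truncn x).+1 => n nx.
apply: le_trans (ltW Bx) _; apply: (slow_le sg) => //.
apply: le_trans (ltW (truncnS_gt x)) _; rewrite ler_nat (leq_trans nx) //.
apply: leq_trans (ltnW (ltn_expl _ (isT : (1 < 2)%N))) _.
by rewrite leq_exp2l // ltnW // ltn_expl.
Qed.

(* Applying the bounded case to min g G first raises the density from c to
   (1 + c) / 2 at the cost of the constant G; the gain (1 - c) / 2 in the
   exponent then absorbs all the losses that depend on g, h, K and c. *)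
Lemma few_exceptions_unbounded : exists2 C : R, 0 < C & forall K c g h N0,
  0 < K -> 0 < c < 1 -> slow K g -> slow K h ->
  (forall x, 1 <= x -> 0 <= g x) -> (forall B : R, exists2 x, 1 <= x & B < g x) ->
  (forall N, (N0 <= N)%N ->
    c * cnt R predT N <= cnt R (fun p => h p%:R <= (H p)%:R) N) ->
  exists n0, forall n N, (n0 <= n)%N -> (tower n < N)%N -> (N <= tower n.+1)%N ->
  cnt R (exceptional g h) N <=
  C * (cnt R predT N * expR (- (c * ln 2 / K * g (tower n.-1)%:R))).
Proof.
have [C C0 HC] := exceptional_le_exp; have [C1 C10 HC1] := few_exceptions_bounded.
exists C => // K c g h N0 K0 /andP[c0 c1] sg sh g0 gU dQ; have l2 := ln2_ge R.
have c01 : 0 <= c <= 1 by apply/andP; split; exact: ltW.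
(* [G] makes the saving in the bounded case exactly [expR (- z)], and [expR z >= z] then leaves at
   most a proportion [(1 - c) / 2] of primes outside [Q]. *)
pose z := C1 / ((1 - c) / 2); pose G := K / (c * ln 2) * z.
have d0 : 0 < (1 - c) / 2 by lra.
have z0 : 0 < z by rewrite divr_gt0.
have ln20 : 0 < ln 2 :> R by lra.
have cl0 : 0 < c * ln 2 by rewrite mulr_gt0.
have G0 : 0 <= G by apply: mulr_ge0; [apply: divr_ge0 |]; exact: ltW.
have expz : C1 * expR (- z) <= (1 - c) / 2.
  rewrite expRN ler_pdivrMr ?expR_gt0 // mulrC -ler_pdivrMr // -/z.
  have := expR_ge1Dx z; lra.
pose g1 x := Num.min (g x) G.
have sg1 : slow K g1.
  case: sg => mg dg; split=> [x y xi yi xy|x x1].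
    by rewrite /g1 le_min !ge_min (mg x y xi yi xy) lexx orbT.
  have := dg x x1; rewrite /g1 => dx.
  have m1 : Num.min (g (x ^+ 2)) G <= g (x ^+ 2) by rewrite ge_min lexx.
  have m2 : Num.min (g (x ^+ 2)) G <= G by rewrite ge_min lexx orbT.
  by case: (leP (g x) G) => _; lra.
have g10 x : 1 <= x -> 0 <= g1 x by move=> x1; rewrite /g1 le_min g0.
have g1G x : 1 <= x -> g1 x <= G by move=> _; rewrite /g1 ge_min lexx orbT.
have [n1 few1] := HC1 K c g1 h N0 G K0 c01 sg1 sh g10 g1G dQ.
have [n2 gG] := unbounded_tower sg (gU G).
have [i1 Ei1] : exists i1, i1 = (maxn n1 n2).+2 by eexists.
pose Q : pred nat := fun p => h p%:R - G <= (H p)%:R.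
pose c' := (1 + c) / 2.
have dQ' m : (tower i1 <= m)%N -> c' * cnt R predT m <= cnt R Q m.
  move=> im; have lt_m : (tower (maxn n1 n2).+1 < m)%N.
    by apply: leq_trans im; rewrite Ei1 ltnNge leq_tower ltnn.
  have [n [i1n nm mn]] := tower_bracket lt_m.
  have n1n : (n1 <= n)%N by have := leq_maxl n1 n2; clear - i1n; lia.
  have n2n : (n2 <= n.-1)%N by have := leq_maxr n1 n2; clear - i1n; lia.
  have := few1 n m n1n nm mn.
  have -> : g1 (tower n.-1)%:R = G by rewrite /g1 min_r // gG.
  have -> : c * ln 2 / K * G = z by rewrite /G; field; rewrite !gt_eqF //; lra.
  have : cnt R (fun p => ~~ Q p) m <= cnt R (exceptional g1 h) m.
    apply: cnt_sub => p pp; apply: contraNN; rewrite /Q => le1; apply: le_trans le1.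
    by rewrite lerD2l lerN2 g1G // ler1n prime_gt0.
  have m0 : 0 <= cnt R predT m by rewrite sumr_ge0.
  have := ler_wpM2l m0 expz; have := cntC R Q m; rewrite /c'.
  set u := cnt R predT m; set v := cnt R _ m; set w := expR _; lra.
have c'01 : 0 <= c' <= 1 by rewrite /c'; apply/andP; split; lra.
pose g00 := g (tower 0)%:R.
have g000 : 0 <= g00 by apply: g0; apply: tower_ge1.
(* [D] bounds the number of scales lost in all; the next threshold makes [g / K] so large that
   [c' * (g / K - D) >= c * (g / K)]. *)
pose D := G / K + g00 / K + i1%:R + 10.
have [n3 small] := tower_le_cnt K0 c01 sg g0.
have [n4 gD] := unbounded_tower sg (gU (c' * D * K / (c' - c))).
exists (n3 + n4 + i1 + 4)%N => n N nge nN Nn.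
have n3n : (n3 <= n)%N by clear - nge; lia.
have n4n : (n4 <= n.-1)%N by clear - nge; lia.
have n2n : (n2 <= n.-1)%N by have := leq_maxr n1 n2; clear - nge Ei1; lia.
have := small n N n3n nN Nn; have := gD _ n4n; have := gG _ n2n.
have := slow_tower0 n.-1 sg; rewrite -/g00.
set T := g (tower n.-1)%:R => T00 TG TD {}small.
have [J EJ] : exists J, J = Num.truncn ((T - G) / K) by eexists.
have TG0 : 0 <= (T - G) / K by rewrite divr_ge0 ?subr_ge0 // ltW.
have JT : J%:R * K <= T - G by rewrite EJ -ler_pdivlMr // truncn_le.
have TJ : (T - G) / K <= J%:R + 1 by rewrite EJ natr1 ltW // truncnS_gt.
(* The window of [J] scales is cut at [i1], below which the density [c'] is not known. *)
have [i Ei] : exists i, i = maxn (n.+1 - J) i1 by eexists.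
apply: (HC K c c' g h Q G n i) => //.
- by move=> m im; apply: dQ'; apply: leq_trans im; rewrite leq_tower Ei leq_maxr.
- by clear - nge; lia.
- by rewrite Ei geq_max leq_subr; clear - nge; lia.
- apply: le_trans JT; rewrite ler_wpM2r ?(ltW K0) // ler_nat.
  by have := leq_maxl (n.+1 - J) i1; rewrite -Ei; clear; lia.
rewrite -/T.
have TK : T / K <= g00 / K + n%:R.
  have n0 : n.-1%:R <= n%:R :> R by rewrite ler_nat leq_pred.
  rewrite ler_pdivrMr // mulrDl divfK ?gt_eqF //; apply: le_trans T00 _.
  by rewrite lerD2l ler_wpM2r // ltW.
have GK0 : 0 <= G / K by rewrite divr_ge0 // ltW.
have gK0 : 0 <= g00 / K by rewrite divr_ge0 // ltW.
have iD : T / K - D <= n%:R - 4 - i%:R.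
  rewrite mulrBl in TJ; rewrite /D Ei.
  have i10 : 0 <= i1%:R :> R by [].
  case: (leqP (n.+1 - J) i1) => [_|lt_i]; first lra.
  rewrite natrB; last by clear - lt_i; lia.
  by rewrite -[n.+1%:R]natr1; lra.
have cc' : 0 < c' - c by rewrite /c'; lra.
have TD' : c' * D <= (c' - c) * (T / K).
  have : c' * D * K <= T * (c' - c) by rewrite -ler_pdivrMr.
  have E : (c' - c) * (T / K) = T * (c' - c) / K by field; rewrite gt_eqF.
  by rewrite E ler_pdivlMr.
have -> : c * ln 2 / K * T = c * (T / K) * ln 2 by field; rewrite gt_eqF.
have c'0 : 0 <= c' by case/andP: c'01.
have := ler_wpM2l c'0 iD.
have l20 : 0 <= ln 2 :> R by lra.
move=> iD'; have le1 : c * (T / K) <= c' * (n%:R - 4 - i%:R) by lra.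
by have := ler_wpM2r l20 le1; lra.
Qed.

End Conclusion.
Theorem theorem6 (R : realType) :
  exists C : R, 0 < C /\
  forall (K c : R) (g h : R -> R),
    0 < K -> 0 < c ->
    {in `[1, +oo[ &, {homo g : x y / x <= y}} ->
    {in `[1, +oo[ &, {homo h : x y / x <= y}} ->
    (forall x : R, 1 <= x -> 0 <= g x <= h x) ->
    (forall x : R, 1 <= x -> h (x ^+ 2) - h x <= K) ->
    (forall x : R, 1 <= x -> g (x ^+ 2) - g x <= K) ->
    (\forall x \near +oo_R,
      c * (prime_pi x)%:R <=
        (count_primes x (fun p => h p%:R <= (H p)%:R))%:R) ->
    \forall x \near +oo_R,
      (count_primes x (fun p => ~~ (h p%:R - g p%:R <= (H p)%:R)))%:R <=
        C * ((prime_pi x)%:R * expR (- (c * ln 2 / K * g x))).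
Proof.
have [C1 C10 bounded] := few_exceptions_bounded R.
have [C2 C20 unbounded] := few_exceptions_unbounded R.
exists ((C1 + C2) * expR 6); split; first by rewrite mulr_gt0 ?addr_gt0 ?expR_gt0.
move=> K c g h K0 c0 mg mh gh sh sg [M [_ dense]].
have slow_g : slow K g by []; have slow_h : slow K h by [].
have g0 x : 1 <= x -> 0 <= g x by move=> /gh/andP[].
pose N0 := (Num.truncn M).+1.
have dQ N : (N0 <= N)%N ->
    c * cnt R predT N <= cnt R (fun p => h p%:R <= (H p)%:R) N.
  move=> N0N; have := dense N%:R.
  rewrite /prime_pi !count_primesE natrK; apply.
  by apply: lt_le_trans (truncnS_gt M) _; rewrite ler_nat.
(* For [c >= 1] the density hypothesis leaves no prime with [H p < h p], hence no exception at
   all. *)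
have [c1|c1] := leP 1 c.
  exists N0%:R; split=> [|x N0x]; first exact: num_real.
  rewrite /prime_pi !count_primesE.
  have x0 : 0 <= x by rewrite (le_trans _ (ltW N0x)).
  have N0N : (N0 <= Num.truncn x)%N by rewrite truncn_ge_nat // ltW.
  have := dQ _ N0N; set N := Num.truncn x.
  set Q : pred nat := fun p => h p%:R <= (H p)%:R.
  have cnt0 : 0 <= cnt R predT N by rewrite sumr_ge0.
  have sub : cnt R (fun p => ~~ (h p%:R - g p%:R <= (H p)%:R)) N <= cnt R (fun p => ~~ Q p) N.
    apply: cnt_sub => p pp; apply: contraNN => /(le_trans _); apply.
    by rewrite gerBl g0 // ler1n prime_gt0.
  have := cntC R Q N => EC dN.
  apply: le_trans (_ : 0 <= _).
    have : 0 <= (c - 1) * cnt R predT N by rewrite mulr_ge0 // subr_ge0.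
    lra.
  by rewrite !mulr_ge0 ?expR_ge0 ?addr_ge0 // ltW.
have c01 : 0 <= c <= 1 by rewrite !ltW.
have [n0 few] : exists n0, forall n N, (n0 <= n)%N -> (tower n < N)%N ->
    (N <= tower n.+1)%N -> cnt R (exceptional g h) N <=
    (C1 + C2) * (cnt R predT N * expR (- (c * ln 2 / K * g (tower n.-1)%:R))).
  have pos N x : 0 <= cnt R predT N * expR x by rewrite mulr_ge0 ?expR_ge0 // sumr_ge0.
  have [[B gB]|gU] := pselect (exists B, forall x, 1 <= x -> g x <= B).
    have [n0 few] := bounded K c g h N0 B K0 c01 slow_g slow_h g0 gB dQ.
    exists n0 => n N n0n nN Nn; apply: le_trans (few n N n0n nN Nn) _.
    by rewrite ler_wpM2r // lerDl ltW.
  have {}gU (B : R) : exists2 x, 1 <= x & B < g x.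
    apply: contrapT => nB; apply: gU; exists B => x x1.
    by rewrite leNgt; apply/negP => Bx; apply: nB; exists x.
  have c0' : 0 < c < 1 by rewrite c0.
  have [n0 few] := unbounded K c g h N0 K0 c0' slow_g slow_h g0 gU dQ.
  exists n0 => n N n0n nN Nn; apply: le_trans (few n N n0n nN Nn) _.
  by rewrite ler_wpM2r // lerDr ltW.
(* The shift to [n0.+1] ensures [n >= 1], so that [n.-1 + 3 = n.+2]; the outer successor absorbs the
   truncation of [x]. *)
exists (tower n0.+1).+1%:R; split=> [|x Mx]; first exact: num_real.
have x0 : 0 <= x by rewrite (le_trans _ (ltW Mx)).
rewrite /prime_pi !count_primesE; set N := Num.truncn x.
have MN : (tower n0.+1 < N)%N by rewrite truncn_ge_nat // ltW.
have [n [n0n nN Nn]] := tower_bracket MN.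
have := few n N (ltnW n0n) nN Nn; move=> /le_trans; apply.
have xn : x <= (tower n.+2)%:R.
  apply: le_trans (ltW (truncnS_gt x)) _; rewrite ler_nat.
  apply: leq_ltn_trans Nn _; rewrite ltnNge leq_tower; lia.
(* Passing from [tower n.-1] to [x] crosses at most three scales; with [c < 1] and [ln 2 < 2] this
   costs at most the factor [expR 6]. *)
have gx : g x <= g (tower n.-1)%:R + 3 * K.
  have x1 : 1 <= x by rewrite -truncn_gt0 (leq_ltn_trans _ nN).
  apply: le_trans (slow_le slow_g x1 xn) _.
  have := slow_tower n.-1 3 slow_g.
  by rewrite (_ : n.-1 + 3 = n.+2)%N //; lia.
rewrite -[leRHS]mulrA ler_wpM2l ?addr_ge0 ?(ltW C10) ?(ltW C20) //.
rewrite mulrCA ler_wpM2l ?sumr_ge0 // -expRD ler_expR.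
have l2 : ln 2 < 2 :> R by apply: ln_sublinear.
have l2' := ln2_ge R.
have q0 : 0 <= c * ln 2 / K by rewrite divr_ge0 ?mulr_ge0 ?ltW //; lra.
have := ler_wpM2l q0 gx.
have -> : c * ln 2 / K * (g (tower n.-1)%:R + 3 * K) =
  c * ln 2 / K * g (tower n.-1)%:R + 3 * (c * ln 2) by field; rewrite gt_eqF.
have : c * ln 2 <= 2 by apply: le_trans (ler_piMl _ (ltW c1)) _; lra.
lra.
Qed.
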